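(* Let $p$ be a prime, $K/\mathbb{Q}_p$ a quadratic extension with ring of integers $\mathcal{O}$ and uniformizer $\pi$. Let $(A_n)_{n\ge1}$ and $(B_n)_{n\ge1}$ be sequences of random finitely generated $\mathcal{O}$-modules. Let $a$ be a non-negative integer and let $\mathcal{M}_a$ be the set of (isomorphism classes of) finite $\mathcal{O}$-modules $M$ such that $\pi^aM=0$. Suppose that for every $G\in\mathcal{M}_a$ the limit $\lim_{n\to\infty}\mathbb{P}(A_n\otimes\mathcal{O}/\pi^a\mathcal{O}\cong G)$ exists and $$\lim_{n\to\infty}\mathbb{E}(\#\mathrm{Sur}_{\mathcal{O}}(A_n,G))=\lim_{n\to\infty}\mathbb{E}(\#\mathrm{Sur}_{\mathcal{O}}(B_n,G))=O(m(G)),$$ where the implied constant does not depend on $G\in\mathcal{M}_a$. Then for every $G\in\mathcal{M}_a$, $$\lim_{n\to\infty}\mathbb{P}(A_n\otimes\mathcal{O}/\pi^a\mathcal{O}\cong G)=\lim_{n\to\infty}\mathbb{P}(B_n\otimes\mathcal{O}/\pi^a\mathcal{O}\cong G).$$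
   Context: Let $\kappa=\mathcal{O}/\pi\mathcal{O}$ be the residue field. Every finite $\mathcal{O}$-module is isomorphic to $G_\lambda:=\prod_{i=1}^r\mathcal{O}/\pi^{\lambda_i}\mathcal{O}$ for a unique partition $\lambda=(\lambda_1\ge\cdots\ge\lambda_r\geq 1)$. With $\lambda'$ the transpose (conjugate) partition of $\lambda$, define $m(G_\lambda):=|\kappa|^{\sum_{j=1}^{\lambda_1}\frac{(\lambda_j')^2}{2}}$. $\mathrm{Sur}_{\mathcal{O}}(M,G)$ is the set of surjective $\mathcal{O}$-module homomorphisms $M\to G$; tensor products are over $\mathcal{O}$. *)

(* Defs.v *)
From HB Require Import structures.
From mathcomp Require Import all_boot all_order all_algebra all_field.
From mathcomp Require Import finmap generic_quotient ring_quotient.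
From mathcomp Require Import all_classical all_reals all_analysis.

Set Implicit Arguments.
Unset Strict Implicit.
Unset Printing Implicit Defensive.

Import Order.TTheory GRing.Theory Num.Theory.
Import numFieldNormedType.Exports.

Local Open Scope classical_set_scope.
Local Open Scope ring_scope.

(** Classical inverses in a commutative ring; as usual in MathComp, the inverse
    of a non-unit is itself. *)
Section ClassicalInverse.
Variable R : comNzRingType.

Definition cunit : pred R := fun x => `[< exists y, y * x = 1 >].

Definition cinv (x : R) : R :=
  if pselect (exists y, y * x = 1) is left h then projT1 (cid h) else x.

Lemma cmulVr : {in cunit, left_inverse 1 cinv *%R}.
Proof.
move=> x; rewrite unfold_in => /asboolP hx.
by rewrite /cinv; case: pselect => // h; case: (cid h).
Qed.

Lemma cunitPl (x y : R) : y * x = 1 -> cunit x.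
Proof. by move=> yx; apply/asboolP; exists y. Qed.

Lemma cinv_out : {in [predC cunit], cinv =1 id}.
Proof.
move=> x; rewrite inE unfold_in => /asboolP nx.
by rewrite /cinv; case: pselect.
Qed.

End ClassicalInverse.

(** The ring Z_p of p-adic integers, as the inverse limit of the Z/p^(n+1)
    (the exponent starts at 1 because 'Z_1 is not the zero ring). *)
Record padic_int (p : nat) (p_pr : prime p) := PadicInt {
  padic_proj : forall n, 'Z_(p ^ n.+1);
  padic_projP : forall n, (padic_proj n.+1 %% p ^ n.+1)%N = padic_proj n }.

Section PadicInt.
Variables (p : nat) (p_pr : prime p).
Local Notation Zp := (padic_int p_pr).

Lemma padic_pX_gt1 n : (1 < p ^ n.+1)%N.
Proof. by rewrite -(exp1n n.+1) ltn_exp2r // prime_gt1. Qed.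

Lemma padic_Zp_cast n : (Zp_trunc (p ^ n.+1)).+2 = (p ^ n.+1)%N.
Proof. exact/Zp_cast/padic_pX_gt1. Qed.

Lemma padic_valD n (x y : 'Z_(p ^ n.+1)) :
  (x + y)%R = ((x + y)%N %% p ^ n.+1)%N :> nat.
Proof. by rewrite /=; congr modn; exact: padic_Zp_cast. Qed.

Lemma padic_valM n (x y : 'Z_(p ^ n.+1)) :
  (x * y)%R = ((x * y)%N %% p ^ n.+1)%N :> nat.
Proof. by rewrite /=; congr modn; exact: padic_Zp_cast. Qed.

Lemma padic_valN n (x : 'Z_(p ^ n.+1)) :
  (- x)%R = ((p ^ n.+1 - x)%N %% p ^ n.+1)%N :> nat.
Proof. by rewrite /=; congr modn; [congr subn|]; exact: padic_Zp_cast. Qed.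

Lemma padic_val_lt n (x : 'Z_(p ^ n.+1)) : (x < p ^ n.+1)%N.
Proof. by have := ltn_ord x; rewrite [X in (_ < X)%N]padic_Zp_cast. Qed.

Lemma padic_dvdX n : (p ^ n.+1 %| p ^ n.+2)%N.
Proof. by rewrite dvdn_exp2l. Qed.

Lemma padic_int_eq (x y : Zp) : (forall n, padic_proj x n = padic_proj y n) -> x = y.
Proof.
case: x y => [x hx] [y hy] /= xy.
have E : x = y by apply: functional_extensionality_dep.
by rewrite E in hx *; congr PadicInt; exact: Prop_irrelevance.
Qed.

HB.instance Definition _ := gen_eqMixin Zp.
HB.instance Definition _ := gen_choiceMixin Zp.

Fact padic_zero_subproof n :
  ((0%R : 'Z_(p ^ n.+2)) %% p ^ n.+1)%N = (0%R : 'Z_(p ^ n.+1)).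
Proof. by rewrite /= mod0n. Qed.

Fact padic_one_subproof n :
  ((1%R : 'Z_(p ^ n.+2)) %% p ^ n.+1)%N = (1%R : 'Z_(p ^ n.+1)).
Proof. by rewrite /= modn_small ?padic_pX_gt1 // modn_small. Qed.

Fact padic_add_subproof (x y : Zp) n :
  (((padic_proj x n.+1 + padic_proj y n.+1)%R : 'Z_(p ^ n.+2)) %% p ^ n.+1)%N =
  (padic_proj x n + padic_proj y n : 'Z_(p ^ n.+1)).
Proof.
rewrite !padic_valD modn_dvdm ?padic_dvdX // -modnDm.
by rewrite !padic_projP.
Qed.

Fact padic_mul_subproof (x y : Zp) n :
  (((padic_proj x n.+1 * padic_proj y n.+1)%R : 'Z_(p ^ n.+2)) %% p ^ n.+1)%N =
  (padic_proj x n * padic_proj y n : 'Z_(p ^ n.+1)).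
Proof.
rewrite !padic_valM modn_dvdm ?padic_dvdX // -modnMm.
by rewrite !padic_projP.
Qed.

Fact padic_opp_subproof (x : Zp) n :
  (((- padic_proj x n.+1)%R : 'Z_(p ^ n.+2)) %% p ^ n.+1)%N =
  (- padic_proj x n : 'Z_(p ^ n.+1)).
Proof.
rewrite !padic_valN modn_dvdm ?padic_dvdX //.
apply/eqP; rewrite -(eqn_modDr (padic_proj x n)).
rewrite subnK ?(ltnW (padic_val_lt _)) // -(padic_projP x n) modnDmr.
by rewrite subnK ?(ltnW (padic_val_lt _)) // modnn; exact: padic_dvdX.
Qed.

Definition padic_zero : Zp := PadicInt p_pr padic_zero_subproof.
Definition padic_one : Zp := PadicInt p_pr padic_one_subproof.
Definition padic_add x y : Zp := PadicInt p_pr (padic_add_subproof x y).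
Definition padic_mul x y : Zp := PadicInt p_pr (padic_mul_subproof x y).
Definition padic_opp x : Zp := PadicInt p_pr (padic_opp_subproof x).

Fact padic_addA : associative padic_add.
Proof. by move=> x y z; apply: padic_int_eq => n; exact: addrA. Qed.
Fact padic_addC : commutative padic_add.
Proof. by move=> x y; apply: padic_int_eq => n; exact: addrC. Qed.
Fact padic_add0 : left_id padic_zero padic_add.
Proof. by move=> x; apply: padic_int_eq => n; exact: add0r. Qed.
Fact padic_addN : left_inverse padic_zero padic_opp padic_add.
Proof. by move=> x; apply: padic_int_eq => n; exact: addNr. Qed.

HB.instance Definition _ :=
  GRing.isZmodule.Build Zp padic_addA padic_addC padic_add0 padic_addN.

Fact padic_mulA : associative padic_mul.
Proof. by move=> x y z; apply: padic_int_eq => n; exact: mulrA. Qed.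
Fact padic_mulC : commutative padic_mul.
Proof. by move=> x y; apply: padic_int_eq => n; exact: mulrC. Qed.
Fact padic_mul1 : left_id padic_one padic_mul.
Proof. by move=> x; apply: padic_int_eq => n; exact: mul1r. Qed.
Fact padic_mulDl : left_distributive padic_mul padic_add.
Proof. by move=> x y z; apply: padic_int_eq => n; exact: mulrDl. Qed.
Fact padic_1_neq0 : padic_one != 0 :> Zp.
Proof. by apply/eqP => /(congr1 (fun z => val (padic_proj z 0))). Qed.

HB.instance Definition _ := GRing.Zmodule_isComNzRing.Build Zp
  padic_mulA padic_mulC padic_mul1 padic_mulDl padic_1_neq0.

HB.instance Definition _ := GRing.ComNzRing_hasMulInverse.Build Zp
  (@cmulVr Zp) (@cunitPl Zp) (@cinv_out Zp).

Lemma padic_proj_mod (x : Zp) n k :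
  (padic_proj x (n + k) %% p ^ n.+1)%N = padic_proj x n.
Proof.
elim: k => [|k <-]; last first.
  rewrite addnS -[in RHS]padic_projP modn_dvdm //.
  by rewrite dvdn_exp2l // ltnS leq_addr.
by rewrite addn0 modn_small // padic_val_lt.
Qed.

Fact padic_idomain (x y : Zp) : x * y = 0 -> (x == 0) || (y == 0).
Proof.
move=> xy0; apply/orP; case: (pselect (x = 0)) => [->|xn0]; first by left.
case: (pselect (y = 0)) => [->|yn0]; first by right.
have nz (z : Zp) : z <> 0 -> exists n, padic_proj z n != 0 :> nat.
  move=> zn0; apply/not_existsP => h; apply: zn0; apply: padic_int_eq => n.
  by apply: val_inj; apply/eqP/negPn/negP/h.
have [n xn] := nz x xn0; have [k yk] := nz y yn0.
have val_le (z : Zp) i j : padic_proj z i != 0 :> nat ->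
    padic_proj z (i + j) != 0 :> nat /\
    (logn p (padic_proj z (i + j)) <= i)%N.
  move=> zi; have nz' : padic_proj z (i + j) != 0 :> nat.
    by apply: contraNneq zi => e; rewrite -(padic_proj_mod z i j) e mod0n.
  split=> //; rewrite leqNgt -pfactor_dvdn ?lt0n //.
  by apply: contra zi => d; rewrite -(padic_proj_mod z i j).
have [xm lx] := val_le x n k xn.
have [ym ly] := val_le y k n yk.
rewrite addnC in ym ly.
have := congr1 (fun z => val (padic_proj z (n + k))) xy0.
rewrite [LHS]padic_valM => /eqP; rewrite -/(dvdn _ _).
rewrite pfactor_dvdn // ?muln_gt0 ?lt0n ?xm // lognM ?lt0n //.
by rewrite ltnNge leq_add.
Qed.

HB.instance Definition _ :=
  GRing.ComUnitRing_isIntegral.Build Zp padic_idomain.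

End PadicInt.

(** The field Q_p. *)
Definition padic (p : nat) (p_pr : prime p) : fieldType :=
  {fraction (padic_int p_pr)}.

Section RingOfIntegers.
Variables (p : nat) (p_pr : prime p) (K : fieldExtType (padic p_pr)).

Definition padic_int_embed : padic_int p_pr -> K :=
  in_alg K \o @tofrac (padic_int p_pr).

HB.instance Definition _ := GRing.RMorphism.on padic_int_embed.

Definition padic_integral : pred K :=
  fun z => `[< integralOver padic_int_embed z >].

Fact padic_integral_subring : subring_closed padic_integral.
Proof.
split; first exact/asboolP/integral1.
- by move=> x y /asboolP xi /asboolP yi; exact/asboolP/integral_sub.
- by move=> x y /asboolP xi /asboolP yi; exact/asboolP/integral_mul.
Qed.

HB.instance Definition _ :=
  GRing.isSubringClosed.Build K padic_integral padic_integral_subring.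

(** The integral closure of Z_p in K. *)
Record ring_of_integers := RingOfIntegers {
  roi_val : K;
  roi_valP : roi_val \in padic_integral }.

HB.instance Definition _ := [isSub for roi_val].
HB.instance Definition _ := [Choice of ring_of_integers by <:].
HB.instance Definition _ :=
  [SubChoice_isSubComNzRing of ring_of_integers by <:].
HB.instance Definition _ := GRing.ComNzRing_hasMulInverse.Build ring_of_integers
  (@cmulVr _) (@cunitPl _) (@cinv_out _).

Fact roi_idomain (x y : ring_of_integers) : x * y = 0 -> (x == 0) || (y == 0).
Proof.
move=> /(congr1 val); rewrite rmorphM rmorph0 => /eqP.
by rewrite mulf_eq0 -!(inj_eq val_inj) rmorph0.
Qed.

HB.instance Definition _ :=
  GRing.ComUnitRing_isIntegral.Build ring_of_integers roi_idomain.

End RingOfIntegers.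

(** A uniformizer generates the maximal ideal, which in a local ring consists
    of the non-units. *)
Definition uniformizer (R : comUnitRingType) (a : R) : Prop :=
  [set x : R | x \isn't a GRing.unit] = [set x * a | x in [set: R]].

Section QuotientModule.
Variables (R : nzRingType) (M : lmodType R) (N : {pred M}).
Hypothesis N_submod : submod_closed N.
Local Open Scope quotient_scope.

Definition zmod_of_submod : zmodClosed M := HB.pack_for (zmodClosed M) N
  (GRing.isZmodClosed.Build M N (GRing.submod_closedB N_submod)).

Definition quotient_module : Type := Quotient.quot zmod_of_submod.

HB.instance Definition _ := GRing.Zmodule.on quotient_module.

Local Notation Q := quotient_module.
Local Notation pi := (\pi_(Quotient.quot zmod_of_submod) : M -> Q).

Definition quotient_scale (a : R) (x : Q) : Q := pi (a *: repr x).

Fact quotient_scale_pi a x : quotient_scale a (pi x) = pi (a *: x).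
Proof.
apply/eqP; rewrite -Quotient.idealrBE -scalerBr.
apply: (GRing.subsemimod_closedZ (GRing.submod_closed_semi N_submod)).
suff : repr (pi x) - x \in zmod_of_submod by [].
by rewrite Quotient.idealrBE reprK.
Qed.

Fact quotient_piD x y : pi (x + y) = pi x + pi y.
Proof. exact: raddfD. Qed.

Fact quotient_scaleA a b x :
  quotient_scale a (quotient_scale b x) = quotient_scale (a * b) x.
Proof. by rewrite [quotient_scale b x]/quotient_scale quotient_scale_pi scalerA. Qed.

Fact quotient_scale1 : left_id 1 quotient_scale.
Proof. by move=> x; rewrite /quotient_scale scale1r reprK. Qed.

Fact quotient_scaleDr : right_distributive quotient_scale +%R.
Proof.
move=> a x y; rewrite -[x]reprK -[y]reprK -quotient_piD !quotient_scale_pi.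
by rewrite scalerDr quotient_piD.
Qed.

Fact quotient_scaleDl x : {morph quotient_scale^~ x : a b / a + b}.
Proof. by move=> a b; rewrite /quotient_scale scalerDl quotient_piD. Qed.

HB.instance Definition _ := GRing.Zmodule_isLmodule.Build R Q
  quotient_scaleA quotient_scale1 quotient_scaleDr quotient_scaleDl.

End QuotientModule.

Section Modules.
Variable R : comNzRingType.

Definition principal (a : R) : pred R^o := fun x => `[< exists y, x = y * a >].

Fact principal_submod a : submod_closed (principal a).
Proof.
split; first by apply/asboolP; exists 0; rewrite mul0r.
move=> b x y /asboolP[x' ->] /asboolP[y' ->]; apply/asboolP.
by exists (b * x' + y'); rewrite mulrDl -mulrA.
Qed.

(** The R-module R/aR. *)
Definition cyclic_module (a : R) : lmodType R :=
  quotient_module (principal_submod a).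

Definition lmod_iso (M N : lmodType R) : Prop :=
  exists f : {linear M -> N}, bijective f.

Definition fin_gen (M : lmodType R) : Prop :=
  exists (n : nat) (g : 'I_n -> M),
    forall x, exists c : 'I_n -> R, x = \sum_i c i *: g i.

Definition bilinear_map (M N T : lmodType R) (t : M -> N -> T) : Prop :=
  (forall x, linear (t x)) /\ (forall y, linear (t^~ y)).

(** [is_tensor M N T]: the tensor product of M and N over R is isomorphic to T,
    i.e. T with some bilinear map satisfies its universal property. *)
Definition is_tensor (M N T : lmodType R) : Prop :=
  exists t : M -> N -> T, bilinear_map t /\
    forall (V : lmodType R) (b : M -> N -> V), bilinear_map b ->
      exists! f : {linear T -> V}, forall x y, f (t x y) = b x y.

Definition Sur (M N : lmodType R) : set {linear M -> N} :=
  [set f : {linear M -> N} | forall y, exists x, f x = y].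
Arguments Sur : clear implicits.

(** Equal to 0 if there are infinitely many surjections, which does not happen
    if M is finitely generated and N is finite. *)
Definition card_Sur (M N : lmodType R) : nat := #|` fset_set (Sur M N)|.

Definition is_partition (l : seq nat) : bool := sorted geq l && all (leq 1) l.

(** The j-th part of the conjugate partition, for j >= 1. *)
Definition conj_part (l : seq nat) (j : nat) : nat := count (leq j) l.

(** The product of the R/a^(l_i)R; the empty product is the zero module R/1R. *)
Definition partition_module (a : R) (l : seq nat) : lmodType R :=
  foldr (fun k (M : lmodType R) => (cyclic_module (a ^+ k) * M)%type : lmodType R)
    (cyclic_module 1) l.

(** The partition l such that G is isomorphic to [partition_module a l]; it
    exists and is unique if G is finite, R is a discrete valuation ring with
    finite residue field and a is a uniformizer. *)
Definition module_type (a : R) (G : lmodType R) : seq nat :=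
  xget [::] [set l | is_partition l /\ lmod_iso G (partition_module a l)].

(** The cardinality of R/aR, i.e. of the residue field if a is a uniformizer. *)
Definition residue_card (a : R) : nat :=
  #|` fset_set [set: cyclic_module a]|.

(** |R/aR| ^ (sum_(1 <= j <= l_1) (l'_j)^2 / 2), where l is the type of G and
    l' is its conjugate. *)
Definition moment_weight (a : R) (G : lmodType R) (U : realType) : U :=
  let l := module_type a G in
  (residue_card a)%:R `^
    (\sum_(1 <= j < (head 0%N l).+1) (conj_part l j)%:R ^+ 2 / 2).

(** The finite modules killed by a^n. *)
Definition finite_killed (a : R) (n : nat) (G : lmodType R) : Prop :=
  finite_set [set: G] /\ forall x : G, a ^+ n *: x = 0.

End Modules.

(** A random finitely generated R-module: a random variable with values in the
    set of isomorphism classes of finitely generated R-modules, with the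
    discrete sigma-algebra (this set is countable for the rings of interest).
    A set of isomorphism classes is an isomorphism-invariant predicate C. *)
Record random_module (R : comNzRingType) (d : measure_display)
    (T : measurableType d) (A : T -> lmodType R) : Prop := RandomModule {
  random_fin_gen : forall w, fin_gen (A w);
  random_measurable : forall C : lmodType R -> Prop,
    (forall M N, lmod_iso M N -> C M -> C N) -> measurable [set w | C (A w)] }.

(* Main.v *)
(** For a surjection [f : X -> F] of finite modules with kernel [K], put
    [q^r = #|Hom(K, kappa)|], where [kappa = O/pi] has [q] elements.  The sum over
    [k] of [(-1)^k q^(k(k-1)/2)] times the number of submodules [L] of [K] with
    [K/L] isomorphic to [kappa^k] is [1] if [K = 0] and [0] otherwise, and its
    truncations are off by at most the first omitted term (Bonferroni).  Summing
    over [f] with [X = M / pi^a M], the [k]-th term becomes a nonnegative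
    combination of the numbers [#Sur(M, N)], where [N] runs over the extensions
    of [F] by [kappa^k].  Hence [P(X = F)] is pinched between two combinations of
    moments which differ by the limit of a single such term.

    That term tends to [0]: an extension [N] of [F] by [kappa^k] splits as
    [kappa^m + N'] with [#|N'| <= #|F|^2], so there is a bounded number of them,
    and for [r = dim N[pi]] one has, up to constants depending on [F],
    [#|Aut N| >= q^(r^2)], [m(N) <= q^(r^2/2)] and [#Sur(N, F) <= q^(rk - k^2)]
    for the surjections with kernel [kappa^k].  The total exponent is at most
    [-k/2 - (k - r)^2/2]. *)
Require Import Defs.
From HB Require Import structures.
From mathcomp Require Import all_boot all_order all_algebra all_field.
From mathcomp Require Import finmap generic_quotient ring_quotient.
From mathcomp Require Import all_classical all_reals all_analysis.
From mathcomp Require Import measurable_realfun.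
From mathcomp Require Import ring lra.

Set Implicit Arguments.
Unset Strict Implicit.
Unset Printing Implicit Defensive.

Import Order.TTheory GRing.Theory Num.Theory.
Import numFieldNormedType.Exports.

Local Open Scope classical_set_scope.
Local Open Scope ring_scope.

(** The moments converge for each module separately, with no uniformity in the module, so the full
    alternating series cannot simply be exchanged with the limit in n. A truncation involves
    finitely many moments, and its error bound is again a nonnegative combination of moments: n
    tends to infinity at fixed k, and k only afterwards. Both bounds depend on the limits of the
    moments alone, hence are common to A and B, and the limit of the probabilities for A passes to
    B. The final exponent is the sum of k(k-1)/2 from the Moebius weight, rk - k^2 from the
    surjections, -r^2 from 1/#Aut N and r^2/2 from m(N). Since r = k can occur, the square gives no
    decay, and what remains is q^(-k/2). Submodules are handled as kernels of surjections; for a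
    finite N the automorphism group is [Sur N N], so that #Aut N appears as [card_Sur N N]. *)

Local Notation Sur M N := (@Sur _ M N).

(** * Cardinals of finite sets *)

Section Counting.
Implicit Types (T U : choiceType).
Local Open Scope card_scope.

(** Infinite sets get the value 0, as in [card_Sur], which unfolds to it. *)
Definition ncard T (A : set T) : nat := #|` fset_set A|.

Lemma ncard_infinite T (A : set T) : ~ finite_set A -> ncard A = 0%N.
Proof. by rewrite /ncard /fset_set => nA; case: pselect. Qed.

Lemma ncard_image T U (f : T -> U) (A : set T) :
  {in A &, injective f} -> ncard (f @` A) = ncard A.
Proof.
move=> fI; case: (pselect (finite_set A)) => [fA|nA].
  rewrite /ncard fset_set_image // card_in_imfset // => x y /=.
  by rewrite !in_fset_set //; exact: fI.
rewrite !ncard_infinite // => fB; apply: nA.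
by apply: card_le_finite fB; have /card_eqPle[] := inj_card_eq fI.
Qed.

Lemma ncard_bij T U (f : T -> U) (g : U -> T) (A : set T) (B : set U) :
  (forall x, A x -> B (f x)) -> (forall y, B y -> A (g y)) ->
  (forall x, A x -> g (f x) = x) -> (forall y, B y -> f (g y) = y) ->
  ncard A = ncard B.
Proof.
move=> fAB gBA gK fK; rewrite -(@ncard_image _ _ f) => [|x y].
  congr ncard; apply/seteqP; split=> [_ [x Ax <-]|y By]; first exact: fAB.
  by exists (g y); [exact: gBA|exact: fK].
by rewrite !inE => Ax Ay e; rewrite -(gK _ Ax) e gK.
Qed.

Lemma leq_ncard_inj T U (f : T -> U) (A : set T) (B : set U) : finite_set B ->
  {in A &, injective f} -> (forall x, A x -> B (f x)) ->
  (ncard A <= ncard B)%N.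
Proof.
move=> fB fI fAB; rewrite -(ncard_image fI); apply: fsubset_leq_card.
have sAB : f @` A `<=` B by move=> _ [x Ax <-]; exact: fAB.
by rewrite -fset_set_sub //; exact: sub_finite_set fB.
Qed.

Lemma subset_ncard T (A B : set T) : finite_set B -> A `<=` B ->
  (ncard A <= ncard B)%N.
Proof. by move=> fB AB; apply: (@leq_ncard_inj _ _ id). Qed.

Lemma ncard_fiber_sum T U (f : T -> U) (A : set T) (B : set U) :
  finite_set A -> finite_set B -> (forall x, A x -> B (f x)) ->
  ncard A = (\sum_(u <- fset_set B) ncard [set x | A x /\ f x = u])%N.
Proof.
move=> fA fB fAB.
have -> : ncard A = (\sum_(x <- fset_set A) \sum_(u <- fset_set B | f x == u) 1)%N.
  rewrite /ncard card_fset_sum1; apply: eq_big_seq => x.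
  rewrite in_fset_set // inE => Ax.
  rewrite big_mkcond (big_fsetD1 (f x)) /=; last by rewrite in_fset_set // inE; exact: fAB.
  rewrite eqxx big_seq big1 ?addn0 // => u.
  by rewrite !inE eq_sym => /andP[/negPf ->].
rewrite (exchange_big_dep predT) //=; apply: eq_bigr => u _.
rewrite /ncard card_fset_sum1 -big_filter; apply: perm_big.
apply: uniq_perm; rewrite ?filter_uniq ?fset_uniq // => x.
rewrite mem_filter in_fset_set // in_fset_set; last by apply: sub_finite_set fA => y [].
by apply/andP/idP; rewrite !inE /= => -[]; [move=> /eqP|move=> + ->].
Qed.

Lemma ncard_fiber T U (f : T -> U) (A : set T) (B : set U) c :
  finite_set A -> finite_set B -> (forall x, A x -> B (f x)) ->
  (forall u, B u -> ncard [set x | A x /\ f x = u] = c) ->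
  ncard A = (ncard B * c)%N.
Proof.
move=> fA fB fAB h; rewrite (ncard_fiber_sum fA fB fAB).
rewrite (eq_big_seq (fun=> c)) => [|u]; last by rewrite in_fset_set // inE => /h.
by rewrite big_const_seq count_predT iter_addn_0 mulnC.
Qed.

Lemma leq_ncard_fiber T U (f : T -> U) (A : set T) (B : set U) c :
  finite_set A -> finite_set B -> (forall x, A x -> B (f x)) ->
  (forall u, B u -> (ncard [set x | A x /\ f x = u] <= c)%N) ->
  (ncard A <= ncard B * c)%N.
Proof.
move=> fA fB fAB h; rewrite (ncard_fiber_sum fA fB fAB).
rewrite (@leq_trans (\sum_(u <- fset_set B) c)%N) //.
  rewrite big_seq [X in (_ <= X)%N]big_seq; apply: leq_sum => u.
  by rewrite in_fset_set // inE => /h.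
by rewrite big_const_seq count_predT iter_addn_0 mulnC.
Qed.

Lemma ncard_setX T U (A : set T) (B : set U) : finite_set A -> finite_set B ->
  ncard (A `*` B) = (ncard A * ncard B)%N.
Proof.
move=> fA fB; apply: (@ncard_fiber _ _ fst) => //; first exact: finite_setX.
  by move=> [? ?] [].
move=> u Au; apply: (@ncard_bij _ _ snd (fun b => (u, b))) => //=.
- by move=> [? ?] [[]].
- by move=> [a b] /= [_ ->].
Qed.

Lemma ncard_setU T (A B : set T) : finite_set A -> finite_set B ->
  (forall x, A x -> ~ B x) -> ncard (A `|` B) = (ncard A + ncard B)%N.
Proof.
move=> fA fB AB; rewrite /ncard fset_setU // cardfsU.
suff -> : (fset_set A `&` fset_set B)%fset = fset0 by rewrite cardfs0 subn0.
apply/fsetP => x; rewrite in_fsetI !in_fset_set //.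
by apply/negP => /andP[]; rewrite !inE => /AB.
Qed.

Lemma ncard_set1 T (x : T) : ncard [set x] = 1%N.
Proof. by rewrite /ncard fset_set1 cardfs1. Qed.

Lemma ncard_gt0 T (A : set T) x : finite_set A -> A x -> (0 < ncard A)%N.
Proof.
move=> fA Ax; rewrite -(ncard_set1 x); apply: subset_ncard => // _ -> //.
Qed.

Lemma ncard_surj T U (f : T -> U) (A : set T) (B : set U) : finite_set A ->
  (forall y, B y -> exists2 x, A x & f x = y) -> (ncard B <= ncard A)%N.
Proof.
move=> fA h; apply: (@leq_trans (ncard (f @` A))).
  by apply: subset_ncard; [exact: finite_image|exact: h].
rewrite /ncard fset_set_image //; exact: leq_imfset_card.
Qed.

Lemma finite_surj (T U : Type) (f : T -> U) : finite_set [set: T] ->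
  (forall y, exists x, f x = y) -> finite_set [set: U].
Proof.
by move=> fT h; apply: sub_finite_set (finite_image f fT) => y _; have [x <-] := h y; exists x.
Qed.

Lemma finite_inj_on (T U : Type) (f : T -> U) (B : set U) : finite_set B ->
  injective f -> (forall x, B (f x)) -> finite_set [set: T].
Proof.
move=> fB fI fT; apply: (@card_le_finite _ _ _ B) => //.
apply: (@card_le_trans _ _ _ (f @` setT)); last by apply: subset_card_le => _ [x _ <-].
have /card_eqPle[] // : f @` setT #= [set: T].
by apply: inj_card_eq => ? ? _ _; exact: fI.
Qed.

Lemma finite_inj (T U : Type) (f : T -> U) : finite_set [set: U] -> injective f ->
  finite_set [set: T].
Proof. by move=> fU fI; apply: (finite_inj_on fU fI). Qed.

Lemma finite_sub T (A : set T) : finite_set [set: T] -> finite_set A.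
Proof. by move=> fT; exact: sub_finite_set fT. Qed.

End Counting.

(** * Linear maps, kernels and quotients *)

Section LinearMaps.
Variable R : comNzRingType.
Implicit Types M N V : lmodType R.

Definition mk_linear M N (f : M -> N) (h : linear f) : {linear M -> N} :=
  HB.pack_for {linear M -> N} f (GRing.isLinear.Build R M N *:%R f h).

Lemma mk_linearE M N (f : M -> N) (h : linear f) x : mk_linear h x = f x.
Proof. by []. Qed.

(** Counting needs equality of the packed maps; beyond the function they contain only proofs, which
    are irrelevant. *)
Lemma linear_eq M N (f g : {linear M -> N}) : f =1 g -> f = g.
Proof.
case: f => f fc; case: g => g gc /= fg.
have {}fg : f = g by apply/funext.
subst g; congr GRing.Linear.Pack.
by case: fc gc => [[a] [b]] [[c] [d]]; congr (GRing.Linear.Class _ _);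
  congr (_ _); exact: Prop_irrelevance.
Qed.

(** The map is [g \o s] for any set-theoretic section [s] of [f]: two lifts differ by an element of
    ker f, which [g] kills, and this makes it linear. *)
Lemma linear_factor M N V (f : {linear M -> N}) (g : {linear M -> V}) :
  (forall y, exists x, f x = y) -> (forall x, f x = 0 -> g x = 0) ->
  exists h : {linear N -> V}, forall x, h (f x) = g x.
Proof.
move=> fS fg; have [s sK] := choice fS.
have gs x : g (s (f x)) = g x.
  by apply/eqP; rewrite -subr_eq0 -linearB fg // linearB sK subrr.
have hl : linear (g \o s).
  move=> c x y /=; rewrite -linearP -[RHS]gs; congr (g (s _)).
  by rewrite linearP !sK.
by exists (mk_linear hl) => x; exact: gs.
Qed.

Lemma inj_surj_iso M N (f : {linear M -> N}) : (forall x, f x = 0 -> x = 0) ->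
  (forall y, exists x, f x = y) -> lmod_iso M N.
Proof.
move=> fI fS; have [s sK] := choice fS; exists f; exists s => // x.
by apply/eqP; rewrite -subr_eq0; apply/eqP/fI; rewrite linearB sK subrr.
Qed.

Lemma lmod_isoP M N : lmod_iso M N -> exists (f : {linear M -> N}) (g : {linear N -> M}),
  cancel f g /\ cancel g f.
Proof.
move=> [f [g fK gK]].
have gl : linear g by move=> c x y; apply: (can_inj fK); rewrite gK linearP !gK.
by exists f, (mk_linear gl).
Qed.

Lemma lmod_iso_refl M : lmod_iso M M.
Proof. by exists (idfun : {linear M -> M}); exists id. Qed.

Lemma lmod_iso_sym M N : lmod_iso M N -> lmod_iso N M.
Proof. by move=> /lmod_isoP[f [g [fK gK]]]; exists g; exists f. Qed.

Lemma lmod_iso_trans M N V : lmod_iso M N -> lmod_iso N V -> lmod_iso M V.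
Proof.
move=> [f fb] [g gb]; exists (g \o f : {linear M -> V}); exact: bij_comp.
Qed.

Lemma surj_ker_iso M N V (f : {linear M -> N}) (g : {linear M -> V}) :
  (forall y, exists x, f x = y) -> (forall y, exists x, g x = y) ->
  (forall x, f x = 0 <-> g x = 0) ->
  exists2 h : {linear N -> V}, (forall x, h (f x) = g x) & bijective h.
Proof.
move=> fS gS fg; have [h hE] := linear_factor fS (fun x => (fg x).1).
have [k kE] := linear_factor gS (fun x => (fg x).2).
exists h => //; exists k => y.
  by have [x <-] := fS y; rewrite hE kE.
by have [x <-] := gS y; rewrite kE hE.
Qed.

End LinearMaps.

Section QuotientFacts.
Variables (R : nzRingType) (M : lmodType R) (N : {pred M}).
Hypothesis N_submod : submod_closed N.
Local Notation Q := (quotient_module N_submod).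
Local Open Scope quotient_scope.

Definition quotient_proj_fun (x : M) : Q :=
  \pi_(Quotient.quot (zmod_of_submod N_submod)) x.

Fact quotient_proj_linear : linear quotient_proj_fun.
Proof.
move=> c x y; rewrite /quotient_proj_fun quotient_piD; congr (_ + _).
by rewrite -[in LHS]quotient_scale_pi.
Qed.

Definition quotient_proj : {linear M -> Q} :=
  HB.pack_for {linear M -> Q} quotient_proj_fun
    (GRing.isLinear.Build R M Q *:%R quotient_proj_fun quotient_proj_linear).
Arguments quotient_proj : simpl never.

Lemma quotient_proj_surj (y : Q) : exists x, quotient_proj x = y.
Proof. by exists (repr y); rewrite /quotient_proj/= /quotient_proj_fun reprK. Qed.

Lemma quotient_proj_eq0 x : quotient_proj x = 0 <-> x \in N.
Proof.
rewrite -[in X in _ <-> X](subr0 x).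
have -> : x - 0 \in N = (x - 0 \in zmod_of_submod N_submod) by [].
rewrite Quotient.idealrBE; split=> [h|/eqP h].
  by apply/eqP; rewrite -[LHS]/(quotient_proj x) h -(linear0 quotient_proj).
by rewrite -[LHS]/(quotient_proj x) -(linear0 quotient_proj).
Qed.

End QuotientFacts.

Section Kernel.
Variables (R : comNzRingType) (M N : lmodType R) (f : {linear M -> N}).

Definition ker_pred : pred M := fun x => f x == 0.

Fact ker_pred_submod : submod_closed ker_pred.
Proof.
split; first by rewrite unfold_in linear0.
by move=> c x y; rewrite !unfold_in linearP => /eqP-> /eqP->; rewrite scaler0 addr0.
Qed.

HB.instance Definition _ := GRing.isSubmodClosed.Build R M ker_pred ker_pred_submod.

(** The kernel as a module of its own, so that linear maps out of it can be counted. *)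
Record kermod := Kermod { kernel_val : M; kernel_valP : kernel_val \in ker_pred }.

HB.instance Definition _ := [isSub for kernel_val].
HB.instance Definition _ := [Choice of kermod by <:].
HB.instance Definition _ := [SubChoice_isSubLmodule of kermod by <:].

Lemma kernelP (x : kermod) : f (val x) = 0.
Proof. exact/eqP/(kernel_valP x). Qed.

Lemma kernel_ex x : f x = 0 -> exists y : kermod, val y = x.
Proof. by move=> /eqP fx; exists (Kermod fx). Qed.

End Kernel.

(** * Finiteness of sets of functions and of subsets *)

Section FiniteFunctions.

Lemma finite_seqs (U : Type) n : finite_set [set: U] ->
  finite_set [set s : seq U | size s = n].
Proof.
move=> fU; elim: n => [|n IH].
  by apply: sub_finite_set (finite_set1 [::]) => -[].
apply: sub_finite_set (finite_image2 (fun x s => x :: s) fU IH) => -[//|x s] /= [es].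
by exists x => //; exists s.
Qed.

Lemma finite_fun (T : choiceType) (U : Type) : finite_set [set: T] ->
  finite_set [set: U] -> finite_set [set: T -> U].
Proof.
move=> /finite_seqP[s sE] fU.
apply: (finite_inj_on (f := fun g : T -> U => map g s) (finite_seqs (size s) fU)).
  move=> g h gh; apply/funext => x; have : x \in s by have : [set` s] x by rewrite -sE.
  by move: gh; elim: s {sE} => //= y s IH [gy /IH gs]; rewrite inE => /predU1P[->|].
by move=> g; exact: size_map.
Qed.

(** A set is a function to [Prop], which by extensionality has only the elements [True] and
    [False]. *)
Lemma finite_sets (T : choiceType) : finite_set [set: T] -> finite_set [set: set T].
Proof.
move=> fT; apply: (finite_fun fT); apply: sub_finite_set (finite_set2 True False).
by move=> P _; case: (pselect P) => h; [left|right]; apply/propext.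
Qed.

End FiniteFunctions.

(** * Counting homomorphisms and surjections *)

Section HomSur.
Variable R : comNzRingType.
Implicit Types M N V G X Y : lmodType R.

Definition nhom M N := ncard [set: {linear M -> N}].

Lemma finite_linear M N : finite_set [set: M] -> finite_set [set: N] ->
  finite_set [set: {linear M -> N}].
Proof.
move=> fM fN.
apply: (finite_inj (f := fun f : {linear M -> N} => f : M -> N) (finite_fun fM fN)) => f g fg.
by apply: linear_eq => x; rewrite fg.
Qed.

Lemma finite_prod M N : finite_set [set: M] -> finite_set [set: N] ->
  finite_set [set: (M * N)%type].
Proof. by move=> fM fN; rewrite -setXTT; exact: finite_setX. Qed.

Lemma card_SurE M N : card_Sur M N = ncard (Sur M N). Proof. by []. Qed.

Lemma sur_iso_l M M' N : lmod_iso M M' -> card_Sur M N = card_Sur M' N.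
Proof.
move=> /lmod_isoP[f [g [fK gK]]].
apply: (@ncard_bij _ _ (fun h : {linear M -> N} => h \o g : {linear M' -> N})
  (fun h : {linear M' -> N} => h \o f : {linear M -> N})).
- by move=> h hS y; have [x <-] := hS y; exists (f x); rewrite /= fK.
- by move=> h hS y; have [x <-] := hS y; exists (g x); rewrite /= gK.
- by move=> h _; apply: linear_eq => x /=; rewrite fK.
- by move=> h _; apply: linear_eq => x /=; rewrite gK.
Qed.

Lemma sur_iso_r M N N' : lmod_iso N N' -> card_Sur M N = card_Sur M N'.
Proof.
move=> /lmod_isoP[f [g [fK gK]]].
apply: (@ncard_bij _ _ (fun h : {linear M -> N} => f \o h : {linear M -> N'})
  (fun h : {linear M -> N'} => g \o h : {linear M -> N})).
- by move=> h hS y; have [x hx] := hS (g y); exists x; rewrite /= hx gK.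
- by move=> h hS y; have [x hx] := hS (f y); exists x; rewrite /= hx fK.
- by move=> h _; apply: linear_eq => x /=; rewrite fK.
- by move=> h _; apply: linear_eq => x /=; rewrite gK.
Qed.

Lemma nhom_prod_l M N V : finite_set [set: {linear M -> V}] ->
  finite_set [set: {linear N -> V}] ->
  nhom (M * N)%type V = (nhom M V * nhom N V)%N.
Proof.
move=> fM fN; rewrite /nhom -ncard_setX //.
have i1 : linear (fun x : M => (x, 0 : N) : (M * N)%type).
  by move=> c x y; congr (_, _); rewrite /= scaler0 addr0.
have i2 : linear (fun x : N => (0 : M, x) : (M * N)%type).
  by move=> c x y; congr (_, _); rewrite /= scaler0 addr0.
have l (u : {linear M -> V} * {linear N -> V}) : linear (fun x : (M * N)%type => u.1 x.1 + u.2 x.2).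
  by move=> c x y /=; rewrite !linearP /= scalerDr addrACA.
apply: (@ncard_bij _ _ (fun f : {linear (M * N)%type -> V} =>
   (f \o mk_linear i1 : {linear M -> V}, f \o mk_linear i2 : {linear N -> V}))
   (fun u => mk_linear (l u))) => //.
- move=> f _; apply: linear_eq => -[x y] /=; rewrite -linearD; congr (f _).
  by congr (_, _); rewrite /= ?addr0 ?add0r.
- move=> [f g] _; congr (_, _); apply: linear_eq => x /=;
  by rewrite linear0 ?addr0 ?add0r.
Qed.

Lemma linear_pair M N V (f : {linear M -> N}) (g : {linear M -> V}) :
  linear (fun x => (f x, g x) : (N * V)%type).
Proof. by move=> c x y; rewrite !linearP. Qed.

Lemma fst_lin M N : linear (fst : (M * N)%type -> M). Proof. by []. Qed.
Lemma snd_lin M N : linear (snd : (M * N)%type -> N). Proof. by []. Qed.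

(** The surjections with the same kernel as a given one form a torsor under
    the automorphism group of their target. *)
Lemma sur_same_kernel X N (u : {linear X -> N}) : finite_set [set: N] -> Sur X N u ->
  ncard [set v | Sur X N v /\ forall x, v x = 0 <-> u x = 0] = card_Sur N N.
Proof.
move=> fN uS; rewrite card_SurE.
(* Pigeonhole: a section of [h] is injective, hence onto the finite N, so [h] is injective. *)
have bij (h : {linear N -> N}) : Sur N N h -> injective h.
  move=> hS; have [s sK] := choice hS.
  have fr := finite_image s fN.
  have sb : range s = [set: N].
    apply/seteqP; split=> // x _; apply: contrapT => nx.
    have lt : (ncard (range s) < ncard [set: N])%N.
      have : ncard (range s `|` [set x]) = (ncard (range s) + 1)%N.
        rewrite ncard_setU ?ncard_set1 // => y sy xy; apply: nx.
        by rewrite -xy.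
      by rewrite addn1 => <-; apply: subset_ncard.
    move: lt; rewrite ncard_image ?ltnn // => y z _ _ /(congr1 h).
    by rewrite !sK.
  have e x : s (h x) = x.
    by have : range s x by [rewrite sb]; move=> [y _ <-]; rewrite sK.
  exact: can_inj e.
(* Choice needs a total function; off the set being counted the value is a dummy [\0]. *)
have ex v : exists a : {linear N -> N}, Sur X N v /\ (forall x, v x = 0 <-> u x = 0) ->
    Sur N N a /\ v = (a \o u : {linear X -> N}).
  case: (pselect (Sur X N v /\ forall x, v x = 0 <-> u x = 0)) => [[vS uv]|n]; last by exists \0.
  have [a aE] := linear_factor uS (fun x => (uv x).2).
  exists a => _; split; last by apply: linear_eq => x; rewrite /= aE.
  by move=> y; have [x <-] := vS y; exists (u x).
have [a aE] := choice ex.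
apply: (@ncard_bij _ _ a (fun h => h \o u : {linear X -> N})).
- by move=> v /aE[].
- move=> h hS; split=> [y|x] /=.
    by have [z <-] := hS y; have [x <-] := uS z; exists x.
  by split=> [e|->]; [apply: (bij h hS); rewrite e linear0|rewrite linear0].
- by move=> v hv; have [_ e] := aE v hv; rewrite -e.
- move=> h hS; have /aE[_ e] : Sur X N (h \o u : {linear X -> N}) /\
      (forall x, (h \o u : {linear X -> N}) x = 0 <-> u x = 0).
    split=> [y|x] /=.
      by have [z <-] := hS y; have [x <-] := uS z; exists x.
    by split=> [e|->]; [apply: (bij h hS); rewrite e linear0|rewrite linear0].
  apply: linear_eq => y; have [x <-] := uS y.
  by have /= := congr1 (fun f : {linear X -> N} => f x) e; move=> <-.
Qed.

Lemma ncard_surj_kernel M N (f : {linear M -> N}) : finite_set [set: M] -> Sur M N f ->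
  ncard [set: M] = (ncard [set: N] * ncard [set x | f x = 0%R])%N.
Proof.
move=> fM fS; have fN := finite_surj fM fS.
apply: (@ncard_fiber _ _ f) => // y _; have [x fx] := fS y.
apply: (@ncard_bij _ _ (fun z => z - x) (fun z => z + x)) => z.
- by move=> [_ fz]; rewrite /= linearB fz fx subrr.
- by move=> /= fz; rewrite linearD fz fx add0r.
- by rewrite subrK.
- by rewrite addrK.
Qed.

End HomSur.

(** * Cyclic modules R/bR *)

Section Cyclic.
Variable R : comNzRingType.

Definition cyc1 (b : R) : cyclic_module b := quotient_proj (principal_submod b) 1.

Lemma cyc_projE (b : R) (c : R^o) : quotient_proj (principal_submod b) c = c *: cyc1 b.
Proof. by rewrite -linearZ; congr (quotient_proj _ _); rewrite /GRing.scale/= mulr1. Qed.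

Lemma cyc_ex (b : R) (y : cyclic_module b) : exists c, y = c *: cyc1 b.
Proof. by have [c <-] := quotient_proj_surj y; exists c; rewrite cyc_projE. Qed.

Lemma cyc_eq0 (b c : R) : c *: cyc1 b = 0 <-> exists d, c = d * b.
Proof. by rewrite -cyc_projE quotient_proj_eq0 unfold_in; split=> /asboolP. Qed.

Lemma cyc_kill (b : R) (y : cyclic_module b) : b *: y = 0.
Proof.
have [c ->] := cyc_ex y; rewrite scalerA mulrC; apply/cyc_eq0; by exists c.
Qed.

Lemma cyc_map (b : R) (M : lmodType R) (x : M) : b *: x = 0 ->
  exists f : {linear cyclic_module b -> M}, f (cyc1 b) = x.
Proof.
move=> bx.
have gl : linear (fun c : R^o => c *: x : M).
  by move=> c y z; rewrite scalerDl -scalerA.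
have [||h hE] := @linear_factor _ _ _ _ (quotient_proj (principal_submod b)) (mk_linear gl).
- exact: quotient_proj_surj.
- by move=> c; rewrite cyc_projE => /cyc_eq0[d ->]; rewrite mk_linearE -scalerA bx scaler0.
by exists h; rewrite -[cyc1 b]/(quotient_proj _ _) hE mk_linearE scale1r.
Qed.

Lemma cyc_linear_eq (b : R) (M : lmodType R) (f g : {linear cyclic_module b -> M}) :
  f (cyc1 b) = g (cyc1 b) -> f = g.
Proof. by move=> e; apply: linear_eq => y; have [c ->] := cyc_ex y; rewrite !linearZ e. Qed.

Lemma cyc_0 (y : cyclic_module (1 : R)) : y = 0.
Proof. by have := cyc_kill y; rewrite scale1r. Qed.

End Cyclic.

(** * Finite modules over a discrete valuation ring *)

Section Uniformizer.
Variables (R : idomainType) (pi : R).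
Hypothesis pi_unif : uniformizer pi.
Hypothesis kfin : finite_set [set: cyclic_module pi].
Implicit Types M N V G X Y : lmodType R.

Local Notation kappa := (cyclic_module pi).
Local Notation one := (cyc1 pi).
Definition rcard := ncard [set: kappa].
Local Notation q := rcard.

Lemma unit_or x : x \is a GRing.unit \/ exists y, x = y * pi.
Proof.
have := congr1 (fun P : set R => P x) pi_unif => /= e.
case: (boolP (x \is a GRing.unit)) => [|h]; [by left|right].
by move: h; rewrite e => -[y _ <-]; exists y.
Qed.

Lemma unit_notpi (x y : R) : x = y * pi -> x \is a GRing.unit -> False.
Proof.
have := congr1 (fun P : set R => P x) pi_unif => /= e xy ux.
have : x \isn't a GRing.unit by rewrite e; exists y.
by rewrite ux.
Qed.

Lemma one_neq0 : one <> 0.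
Proof. by rewrite -[one]scale1r => /cyc_eq0[d /unit_notpi]; apply; exact: unitr1. Qed.

Lemma kappa_simple (z : kappa) : z <> 0 -> exists c, c *: z = one.
Proof.
have [d ->] := cyc_ex z => h; have [u|[y e]] := unit_or d.
  by exists d^-1; rewrite scalerA mulVr // scale1r.
by case: h; apply/cyc_eq0; exists y.
Qed.

Lemma rcard_gt1 : (1 < q)%N.
Proof.
rewrite /q (_ : 2%N = ncard ([set (0 : kappa)] `|` [set one])).
  exact: subset_ncard.
by rewrite ncard_setU ?ncard_set1 // => x -> /esym/one_neq0.
Qed.

(** A pair (u, v) is onto exactly when u is onto and v does not vanish on ker u, because kappa is
    simple. The bad pairs [A2] are those in which v factors through u, one for each element of
    Hom(G, kappa). *)
Lemma sur_prod_kappa Y G : finite_set [set: Y] -> finite_set [set: G] ->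
  card_Sur Y (G * kappa)%type = (card_Sur Y G * (nhom Y kappa - nhom G kappa))%N.
Proof.
move=> fY fG; rewrite !card_SurE mulnBr.
have fYG := finite_linear fY fG.
have fYk := finite_linear fY kfin; have fGk := finite_linear fG kfin.
rewrite /nhom -!ncard_setX //; try exact: finite_sub.
set S := _ `*` [set: {linear Y -> _}].
have fS : finite_set S by apply: finite_setX => //; exact: finite_sub.
pose A2 := S `&` [set u : {linear Y -> G} * {linear Y -> kappa} | forall x, u.1 x = 0 -> u.2 x = 0].
have <- : ncard A2 = ncard (Sur Y G `*` [set: {linear G -> kappa}]).
  rewrite -(@ncard_image _ _ (fun u : {linear Y -> G} * {linear G -> kappa} =>
    (u.1, u.2 \o u.1 : {linear Y -> kappa}))) => [|[u f] [v g]]; last first.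
    rewrite !inE => -[/= uS _] [/= vS _] [uv fg]; rewrite -uv in fg *.
    congr (_, _); apply: linear_eq => y; have [x <-] := uS y.
    by have := congr1 (fun h => h x) fg.
  congr ncard; apply/seteqP; split=> [[u f] [[/= uS _] uf]|_ [[u f] [/= uS _] <-]].
    have [h hE] := linear_factor uS uf.
    by exists (u, h) => //; congr (_, _); apply: linear_eq.
  by split=> //= x ->; rewrite linear0.
have -> : ncard S = (ncard (S `\` A2) + ncard A2)%N.
  rewrite -ncard_setU; first congr ncard.
  - apply/seteqP; split=> x; last by move=> [[]|[]].
    by move=> Sx; case: (pselect (A2 x)); [right|left].
  - exact: finite_setD.
  - exact: finite_setIl.
  - by move=> x [].
rewrite addnK.
have pl (u : {linear Y -> G} * {linear Y -> kappa}) := linear_pair u.1 u.2.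
symmetry; apply: (@ncard_bij _ _ (fun u => mk_linear (pl u))
  (fun f => (mk_linear (@fst_lin _ G kappa) \o f : {linear Y -> G},
             mk_linear (@snd_lin _ G kappa) \o f : {linear Y -> kappa}))).
- move=> [u v] [[/= uS _] nA2] [g k].
  have [x [ux vx]] : exists x, u x = 0 /\ v x <> 0.
    apply: contrapT => h; apply: nA2; split=> //= x ux.
    by apply: contrapT => vx; apply: h; exists x.
  have [c cvx] := kappa_simple vx; have [y uy] := uS g; have [d dE] := cyc_ex (k - v y).
  exists (y + (d * c) *: x); rewrite /= linearD uy linearZ /= ux scaler0 addr0.
  by rewrite linearD linearZ /= -scalerA cvx -dE addrC subrK.
- move=> f fsur; split.
    by split=> //= g; have [x fx] := fsur (g, 0); exists x; rewrite /= fx.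
  move=> [_ /= h]; have [x fx] := fsur (0, one); apply: one_neq0.
  by have := h x; rewrite fx /=; apply.
- by move=> [u v] _; congr (_, _); apply: linear_eq.
- by move=> f _; apply: linear_eq => x /=; case: (f x).
Qed.

(** The orders of the socle N[pi] and, below, of pi N. *)
Definition soc_card N := ncard [set x : N | pi *: x = 0].
Definition rad_card N := ncard [set pi *: x | x in [set: N]].

Lemma soc_rad N : finite_set [set: N] -> ncard [set: N] = (rad_card N * soc_card N)%N.
Proof.
move=> fN; apply: (@ncard_fiber _ _ (fun x => pi *: x)) => // [|_ [x _ <-]].
  exact: finite_image.
apply: (@ncard_bij _ _ (fun z => z - x) (fun z => z + x)) => z.
- by move=> [_ e]; rewrite /= scalerBr e subrr.
- by move=> /= e; rewrite scalerDr e add0r.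
- by rewrite subrK.
- by rewrite addrK.
Qed.

Lemma nhom_kappa N : nhom kappa N = soc_card N.
Proof.
have ex (x : N) : exists f : {linear kappa -> N}, pi *: x = 0 -> f one = x.
  case: (pselect (pi *: x = 0)) => [/cyc_map[f fx]|n]; first by exists f.
  by exists \0.
have [g gE] := choice ex.
apply: (@ncard_bij _ _ (fun f : {linear kappa -> N} => f one) g) => //.
- by move=> f _; rewrite /= -linearZ cyc_kill linear0.
- by move=> f _; apply: cyc_linear_eq; apply: gE; rewrite -linearZ cyc_kill linear0.
Qed.

Lemma soc_kappa : soc_card kappa = q.
Proof.
by congr ncard; apply/seteqP; split=> // x _; exact: cyc_kill.
Qed.

Definition addk G m : lmodType R := iter m (fun G : lmodType R => (G * kappa)%type : lmodType R) G.

Lemma addk_iso G G' m : lmod_iso G G' -> lmod_iso (addk G m) (addk G' m).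
Proof.
move=> GG'; elim: m => //= m /lmod_isoP[f [g [fK gK]]].
have fl : linear (fun u : (addk G m * kappa)%type => (f u.1, u.2) : (addk G' m * kappa)%type).
  by move=> d [u1 u2] [v1 v2]; congr (_, _); rewrite /= linearP.
exists (mk_linear fl), (fun u => (g u.1, u.2)) => -[u v];
  by congr (_, _); rewrite /= ?fK ?gK.
Qed.

Lemma finite_addk G m : finite_set [set: G] -> finite_set [set: addk G m].
Proof. by move=> fG; elim: m => //= m IH; exact: finite_prod. Qed.

Lemma nhom_addk_l G m N : finite_set [set: G] -> finite_set [set: N] ->
  nhom (addk G m) N = (nhom G N * soc_card N ^ m)%N.
Proof.
move=> fG fN; elim: m => [|m IH]; first by rewrite muln1.
rewrite nhom_prod_l; [|exact: (finite_linear (finite_addk m fG))|exact: finite_linear].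
by rewrite IH nhom_kappa expnSr mulnA.
Qed.

Lemma nhom_addk G m : finite_set [set: G] ->
  nhom (addk G m) kappa = (nhom G kappa * q ^ m)%N.
Proof. by move=> fG; rewrite nhom_addk_l // soc_kappa. Qed.

Lemma sur_addk Y G m : finite_set [set: Y] -> finite_set [set: G] ->
  card_Sur Y (addk G m) =
  (card_Sur Y G * \prod_(i < m) (nhom Y kappa - nhom G kappa * q ^ i))%N.
Proof.
move=> fY fG; elim: m => [|m IH]; first by rewrite big_ord0 muln1.
rewrite sur_prod_kappa //; last exact: finite_addk.
by rewrite IH big_ord_recr /= mulnA nhom_addk.
Qed.

(** The zero module R/1R. *)
Local Notation Z := (cyclic_module (1 : R)).

Lemma finite_Z : finite_set [set: Z].
Proof. by apply: sub_finite_set (finite_set1 0) => x _; exact: cyc_0. Qed.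

Lemma nhom_Z N : nhom Z N = 1%N.
Proof.
rewrite /nhom -(ncard_set1 (\0 : {linear Z -> N})); congr ncard.
by apply/seteqP; split=> // f _; apply: linear_eq => x; rewrite (cyc_0 x) !linear0.
Qed.

Lemma sur_Z Y : card_Sur Y Z = 1%N.
Proof.
rewrite card_SurE -(ncard_set1 (\0 : {linear Y -> Z})); congr ncard.
apply/seteqP; split=> [f _|_ -> y]; last by exists 0; rewrite (cyc_0 y) linear0.
by apply: linear_eq => x; exact: etrans (cyc_0 _) (esym (cyc_0 _)).
Qed.

Definition kpow m := addk Z m.

Lemma ncard_addk G m : finite_set [set: G] ->
  ncard [set: addk G m] = (ncard [set: G] * q ^ m)%N.
Proof.
move=> fG; elim: m => [|m IH]; first by rewrite muln1.
rewrite -setXTT ncard_setX //; last exact: finite_addk.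
by rewrite IH expnSr mulnA.
Qed.

Lemma ncard_Z : ncard [set: Z] = 1%N.
Proof.
by rewrite (_ : [set: Z] = [set 0]) ?ncard_set1 //; apply/seteqP; split=> // x _; exact: cyc_0.
Qed.

Lemma ncard_kpow m : ncard [set: kpow m] = (q ^ m)%N.
Proof. by rewrite ncard_addk ?ncard_Z ?mul1n //; exact: finite_Z. Qed.

Lemma kpow_kill m (x : kpow m) : pi *: x = 0.
Proof.
elim: m x => [x|m IH [x y]]; first exact: cyc_0.
by congr (_, _); [exact: IH|exact: cyc_kill].
Qed.

Lemma sur_kpow Y m : finite_set [set: Y] ->
  card_Sur Y (kpow m) = (\prod_(i < m) (nhom Y kappa - q ^ i))%N.
Proof.
move=> fY; rewrite sur_addk //; last exact: finite_Z.
by rewrite sur_Z mul1n nhom_Z; under eq_bigr do rewrite mul1n.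
Qed.

Definition submod N (L : set N) :=
  L 0 /\ forall c x y, L x -> L y -> L (c *: x + y).

(** Among the submodules containing pi N but not x, let L have the largest order. Then N/L is
    generated by x and isomorphic to kappa, and [h] is the projection: it sends y to the class of a
    scalar c with y - c x in L. *)
Lemma kappa_separates N (x : N) : finite_set [set: N] ->
  (forall y, x <> pi *: y) -> exists h : {linear N -> kappa}, h x <> 0.
Proof.
move=> fN xpi.
pose good L := [/\ submod L, (forall y : N, L (pi *: y)) & ~ L x].
pose P n := `[< exists2 L, good L & ncard L = n >].
have Pex : exists n, P n.
  exists (rad_card N); apply/asboolP; exists [set pi *: x | x in [set: N]] => //.
  split; [|by move=> y; exists y|by move=> [y _ /esym]; exact: xpi].
  split=> [|c _ _ [y _ <-] [z _ <-]]; first by exists 0; rewrite ?scaler0.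
  by exists (c *: y + z) => //; rewrite scalerDr !scalerA mulrC.
have Pb n : P n -> (n <= ncard [set: N])%N.
  by move=> /asboolP[L _ <-]; exact: subset_ncard.
case: (ex_maxnP Pex Pb) => n /asboolP[L [[L0 Lc] Lpi Lx] Ln] nmax.
have LN y : L y -> L (- y) by move=> Ly; rewrite -[- y]addr0 -scaleN1r; exact: Lc.
have LD y z : L y -> L z -> L (y + z) by move=> Ly Lz; rewrite -[y]scale1r; exact: Lc.
have LZ c y : L y -> L (c *: y) by move=> Ly; rewrite -[_ *: _]addr0; exact: Lc.
have Lu c : L (c *: x) -> exists d, c = d * pi.
  have [u|//] := unit_or c; move=> /(LZ c^-1); rewrite scalerA mulVr // scale1r //.
(* Otherwise L' = L + Ry is strictly larger than L, so it contains x by maximality. *)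
have dec y : exists c, L (y - c *: x).
  case: (pselect (L y)) => [Ly|nLy]; first by exists 0; rewrite scale0r subr0.
  pose L' := [set z | exists c, L (z - c *: y)].
  have L'x : L' x.
    apply: contrapT => nL'x; have : P (ncard L').
      apply/asboolP; exists L' => //; split=> //; last first.
        by move=> z; exists 0; rewrite scale0r subr0.
      split=> [|c u v [d du] [e ev]]; first by exists 0; rewrite scale0r subr0.
      exists (c * d + e); rewrite scalerDl opprD addrACA -scalerA -scalerBr.
      exact: Lc.
    move=> /nmax; apply/negP; rewrite -ltnNge -Ln.
    rewrite (@leq_trans (ncard (L `|` [set y]))) //.
      rewrite ncard_setU ?ncard_set1 ?addn1 //; first exact: finite_sub.
      by move=> z Lz zy; rewrite -zy in nLy.
    apply: subset_ncard; first exact: finite_sub.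
    move=> z [Lz|->]; first by exists 0; rewrite scale0r subr0.
    by exists 1; rewrite scale1r subrr.
  (* If x = c y modulo L, then c is a unit and y is a multiple of x: a multiple of pi would put c y
     in pi N, hence x in L. *)
  have [c Lc'] := L'x; have [u|[d cE]] := unit_or c.
    exists c^-1; have := LN _ (LZ c^-1 _ Lc').
    by rewrite scalerBr scalerA mulVr // scale1r opprB.
  exfalso; apply: Lx; rewrite -(subrK (c *: y) x); apply: LD => //.
  by rewrite cE -scalerA; exact: LZ.
have [s sE] := choice dec.
have hl : linear (fun y => s y *: one : kappa).
  move=> c y z; rewrite scalerA -scalerDl; apply/eqP; rewrite -subr_eq0 -scalerBl; apply/eqP.
  apply/cyc_eq0/Lu.
  have -> : (s (c *: y + z) - (c * s y + s z)) *: x =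
      (c *: (y - s y *: x) + (z - s z *: x)) + - ((c *: y + z) - s (c *: y + z) *: x).
    rewrite scalerBl scalerDl scalerBr scalerA addrACA -opprD opprB.
    by rewrite [RHS]addrC addrA subrK.
  by apply: LD; [apply: Lc => //|exact: LN].
(* Both s(x) and 1 - s(x) would be multiples of pi, hence so would 1. *)
exists (mk_linear hl); rewrite mk_linearE => /cyc_eq0[d sd].
have := sE x; rewrite -[X in X - _]scale1r -scalerBl => /Lu[e e1].
apply: (@unit_notpi 1 (e + d)); rewrite ?unitr1 //.
by rewrite mulrDl -sd -e1 subrK.
Qed.

Lemma ltn_rcardX n : (n < q ^ n)%N.
Proof. exact/ltn_expl/rcard_gt1. Qed.

(** The surjection of maximal rank onto a power of the residue field has kernel
    [pi N], so that [N / pi N] is that power and is dual to [Hom(N, kappa)]. *)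
Lemma rankP N : finite_set [set: N] ->
  exists r, nhom N kappa = (q ^ r)%N /\ soc_card N = (q ^ r)%N.
Proof.
move=> fN.
pose P n := `[< exists g : {linear N -> kpow n}, forall y, exists x, g x = y >].
have Pex : exists n, P n.
  by exists 0%N; apply/asboolP; exists \0 => y; exists 0; rewrite (cyc_0 y) linear0.
have Pb n : P n -> (n <= ncard [set: N])%N.
  move=> /asboolP[g gS]; apply: leq_trans (ltnW (ltn_rcardX n)) _.
  rewrite -ncard_kpow; apply: (@ncard_surj _ _ g) => // y _.
  by have [x <-] := gS y; exists x.
case: (ex_maxnP Pex Pb) => r /asboolP[g gS] rmax; exists r.
have fr := finite_surj fN gS.
(* A functional not vanishing on ker g would extend [g] to a surjection onto kappa^(r+1), against
   maximality. *)
have hg (h : {linear N -> kappa}) x : g x = 0 -> h x = 0.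
  move=> gx; apply: contrapT => hx; suff: P r.+1 by move=> /rmax; rewrite ltnn.
  have [c chx] := kappa_simple hx.
  apply/asboolP; exists (mk_linear (linear_pair g h)) => -[u v].
  have [y gy] := gS u; have [d dE] := cyc_ex (v - h y).
  exists (y + (d * c) *: x); congr (_, _); rewrite /= linearD linearZ /=.
    by rewrite gx scaler0 addr0.
  by rewrite -scalerA chx -dE addrC subrK.
have hN : nhom N kappa = (q ^ r)%N.
  transitivity (nhom (kpow r) kappa); last first.
    by rewrite nhom_addk ?nhom_Z ?mul1n //; exact: finite_Z.
  have ex (h : {linear N -> kappa}) : exists k : {linear kpow r -> kappa}, forall x, k (g x) = h x.
    by have [k kE] := linear_factor gS (hg h); exists k.
  have [k kE] := choice ex.
  apply: (@ncard_bij _ _ k (fun f => f \o g : {linear N -> kappa})) => // f _.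
    by apply: linear_eq => x /=; rewrite kE.
  by apply: linear_eq => y; have [x <-] := gS y; rewrite kE.
split=> //.
have kerg : [set x | g x = 0] = [set pi *: x | x in [set: N]].
  apply/seteqP; split=> [x /= gx|_ [x _ <-]]; last by rewrite /= linearZ; exact: kpow_kill.
  apply: contrapT => nx; have [|h hx] := @kappa_separates N x fN.
    by move=> y xy; apply: nx; exists y.
  exact: (hx (hg h x gx)).
have := ncard_surj_kernel fN gS; rewrite kerg -/(rad_card N) soc_rad // ncard_kpow.
rewrite mulnC => /eqP; rewrite eqn_pmul2r => [/eqP//|].
by apply: (@ncard_gt0 _ _ 0); [exact: finite_image|exists 0; rewrite ?scaler0].
Qed.

Lemma nhom_soc N : finite_set [set: N] -> nhom N kappa = soc_card N.
Proof. by move=> /rankP[r [-> ->]]. Qed.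

Lemma soc_addk G m : finite_set [set: G] -> soc_card (addk G m) = (soc_card G * q ^ m)%N.
Proof.
by move=> fG; rewrite -nhom_soc ?nhom_addk ?nhom_soc //; exact: finite_addk.
Qed.

Lemma rad_addk G m : finite_set [set: G] -> rad_card (addk G m) = rad_card G.
Proof.
move=> fG; have f := finite_addk m fG.
have := soc_rad f; rewrite ncard_addk // soc_rad // soc_addk // mulnA => /eqP.
rewrite eqn_pmul2r ?expn_gt0 ?(ltnW rcard_gt1) // eqn_pmul2r => [/eqP//|].
by apply: (@ncard_gt0 _ _ 0); [exact: finite_sub|rewrite /= scaler0].
Qed.

Lemma iso_ncard M N : lmod_iso M N -> ncard [set: M] = ncard [set: N].
Proof. by move=> [f [g fK gK]]; apply: (@ncard_bij _ _ f g). Qed.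

Lemma iso_soc M N : lmod_iso M N -> soc_card M = soc_card N.
Proof.
move=> /lmod_isoP[f [g [fK gK]]]; apply: (@ncard_bij _ _ f g) => // x /= e.
  by rewrite -linearZ e linear0.
by rewrite -linearZ e linear0.
Qed.

Lemma iso_finite M N : lmod_iso M N -> finite_set [set: M] -> finite_set [set: N].
Proof. by move=> [f [g fK gK]] fM; apply: finite_surj fM _ => y; exists (g y). Qed.

Lemma iso_killed a M N : lmod_iso M N -> finite_killed pi a M -> finite_killed pi a N.
Proof.
move=> MN [fM kM]; split; first exact: iso_finite fM.
have [f [g fK gK]] := MN => x.
by rewrite -(gK x) -linearZ kM linear0.
Qed.

(** A functional with h(x) nonzero retracts N onto the line Rx, which is a copy of kappa; hence N is
    the sum of N/Rx and kappa. *)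
Lemma split_kappa N (x : N) : finite_set [set: N] -> pi *: x = 0 ->
  (forall y, x <> pi *: y) -> exists N', lmod_iso N (N' * kappa)%type.
Proof.
move=> fN px xpi; have [h hx] := kappa_separates fN xpi.
have [c chx] := kappa_simple hx.
pose L := fun y => `[< exists d, y = d *: x >] : bool.
have Ls : submod_closed (L : {pred N}).
  split; first by apply/asboolP; exists 0; rewrite scale0r.
  move=> e _ _ /asboolP[d ->] /asboolP[d' ->]; apply/asboolP.
  by exists (e * d + d'); rewrite scalerDl scalerA.
exists (quotient_module Ls).
apply: (@inj_surj_iso _ _ _ (mk_linear (linear_pair (quotient_proj Ls) h))).
  move=> y [/quotient_proj_eq0/asboolP[d yE]]; rewrite yE linearZ /= => hd.
  have [u|[e ->]] := unit_or d; last by rewrite -scalerA px scaler0.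
  by case: hx; rewrite -[h x]scale1r -(mulVr u) -scalerA hd scaler0.
move=> [u v]; have [y yu] := quotient_proj_surj u; have [d dE] := cyc_ex (v - h y).
exists (y + (d * c) *: x).
have e1 : quotient_proj Ls ((d * c) *: x) = 0.
  by apply/quotient_proj_eq0/asboolP; exists (d * c).
rewrite mk_linearE linearD e1 addr0 yu; congr (_, _).
by rewrite linearD linearZ /= -scalerA chx -dE addrC subrK.
Qed.

(** Copies of kappa are split off as long as the socle is not inside pi N. At the end N'[pi] lies in
    pi N', so #|N'| is at most the square of #|pi N'|; this is what bounds N' for the extensions of
    a fixed module. *)
Lemma split_socle a N : finite_killed pi a N -> exists m N',
  [/\ lmod_iso N (addk N' m), finite_killed pi a N' & (soc_card N' <= rad_card N')%N].
Proof.
have [n] := ubnP (ncard [set: N]); elim: n N => // n IH N; rewrite ltnS => Nn [fN kN].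
case: (pselect (exists x : N, pi *: x = 0 /\ forall y, x <> pi *: y)) => [[x [px xpi]]|h].
  have [N' NN'] := split_kappa fN px xpi.
  have fN'k := iso_finite NN' fN.
  have fN' : finite_set [set: N'].
    by apply: (finite_surj (f := fst) fN'k) => y; exists (y, 0).
  have kN' : finite_killed pi a N'.
    split=> // y; have [_ /(_ (y, 0))/(congr1 fst)] := iso_killed NN' (conj fN kN).
    by [].
  have [|m [N'' [iso k s]]] := IH N' _ kN'.
    rewrite (leq_trans _ Nn) // (iso_ncard NN') (ncard_addk 1 fN') expn1.
    rewrite ltn_Pmulr ?rcard_gt1 //; exact: (@ncard_gt0 _ _ 0).
  by exists m.+1, N''; split=> //; exact: lmod_iso_trans NN' (addk_iso 1 iso).
exists 0%N, N; split=> //; first exact: lmod_iso_refl.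
apply: subset_ncard; first exact: finite_image.
move=> x px; apply: contrapT => nx; apply: h; exists x; split=> // y e.
by apply: nx; exists y.
Qed.

End Uniformizer.

Lemma ncard_cover (T : choiceType) (I : finType) (P : pred I) (A : set T)
    (B : I -> set T) : finite_set A ->
  (forall x, A x -> exists2 i, P i & B i x) ->
  (forall i x, P i -> B i x -> A x) ->
  (forall i j x, P i -> P j -> B i x -> B j x -> i = j) ->
  ncard A = (\sum_(i | P i) ncard (B i))%N.
Proof.
move=> fA AB BA uB.
rewrite {1}/ncard card_fset_sum1.
have -> : (\sum_(x <- fset_set A) 1 =
    \sum_(x <- fset_set A) \sum_(i | P i && (x \in B i)) 1)%N.
  apply: eq_big_seq => x; rewrite in_fset_set // inE => /AB[i Pi Bi].
  rewrite (big_pred1 i) // => j /=; apply/andP/eqP => [[Pj]|->].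
    by rewrite inE => Bj; exact: uB Pj Pi Bj Bi.
  by rewrite inE.
rewrite (exchange_big_dep P) //=; last by move=> x i _ /andP[].
apply: eq_bigr => i Pi; rewrite /ncard card_fset_sum1 -big_filter; apply: perm_big.
apply: uniq_perm; rewrite ?filter_uniq ?fset_uniq // => x.
rewrite mem_filter Pi in_fset_set // in_fset_set; last by apply: sub_finite_set fA => y; exact: BA.
by apply/andP/idP => [[]//|Bx]; split=> //; rewrite !inE in Bx *; exact: BA Bx.
Qed.

(** * Extensions by a power of the residue field *)

Section Chains.
Variables (R : idomainType) (pi : R).
Hypothesis pi_unif : uniformizer pi.
Hypothesis kfin : finite_set [set: cyclic_module pi].
Implicit Types (M N G X Y F : lmodType R) (k : nat).
Local Notation kappa := (cyclic_module pi).
Local Notation q := (rcard pi).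
Local Notation kpow := (kpow pi).

Lemma kernel_map M N M' N' (f : {linear M -> N}) (f' : {linear M' -> N'})
    (u : {linear M -> M'}) : (forall x, f x = 0 -> f' (u x) = 0) ->
  exists w : {linear kermod f -> kermod f'}, forall x, val (w x) = u (val x).
Proof.
move=> fu.
have ex (x : kermod f) : exists y : kermod f', val y = u (val x).
  by apply: kernel_ex; apply/fu/kernelP.
have [w wE] := choice ex.
have wl : linear w.
  by move=> c x y; apply: val_inj; rewrite linearP /= !wE -linearP -linearP.
by exists (mk_linear wl).
Qed.

Lemma finite_kermod M N (f : {linear M -> N}) : finite_set [set: M] ->
  finite_set [set: kermod f].
Proof. by move=> fM; exact: (finite_inj fM (@val_inj _ _ (kermod f))). Qed.

(** The submodules [L] of [ker f] with [ker f / L] isomorphic to [kappa^k]. *)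
Definition kpow_sub X N k (f : {linear X -> N}) : set (set X) :=
  [set L | exists g : {linear kermod f -> kpow k}, (forall y, exists x, g x = y) /\
    L = [set x | exists2 y : kermod f, val y = x & g y = 0]].

Lemma kpow_sub_ker X N k (f : {linear X -> N}) (g : {linear kermod f -> kpow k}) (y : kermod f) :
  [set x | exists2 y : kermod f, val y = x & g y = 0] (val y) <-> g y = 0.
Proof. by split=> [[z /val_inj <-]//|gy]; exists y. Qed.

(** Each such submodule is the kernel of exactly #Aut(kappa^k) surjections from ker f. *)
Lemma ncard_kpow_sub X N k (f : {linear X -> N}) : finite_set [set: X] ->
  (ncard (kpow_sub k f) * card_Sur (kpow k) (kpow k))%N = card_Sur (kermod f) (kpow k).
Proof.
move=> fX; have fk := finite_kermod f fX.
have fp : finite_set [set: kpow k] by apply: finite_addk => //; exact: finite_Z.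
rewrite [RHS]card_SurE; symmetry.
apply: (@ncard_fiber _ _ (fun g : {linear kermod f -> kpow k} =>
   [set x | exists2 y : kermod f, val y = x & g y = 0])).
- by apply: finite_sub; exact: finite_linear.
- by apply: finite_sub; exact: finite_sets.
- by move=> g gS; exists g.
move=> L [g [gS ->]]; rewrite -(sur_same_kernel fp gS); congr ncard.
apply/seteqP; split=> v [vS e]; split=> //.
  by move=> y; rewrite -!kpow_sub_ker e.
by apply/seteqP; split=> x [y yx] /e gy; exists y.
Qed.

Definition kpow_ext F k N : set {linear N -> F} :=
  [set h | Sur N F h /\ exists g : {linear kermod h -> kpow k}, bijective g].

(** Equivalently a chain X -> X/L -> F of surjections, the second with kernel kappa^k. *)
Definition kpow_chain X F k : set ({linear X -> F} * set X) :=
  [set u | Sur X F u.1 /\ kpow_sub k u.1 u.2].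

Lemma kpow_chain_comp X N F k (u : {linear X -> N}) (h : {linear N -> F}) :
  Sur X N u -> kpow_ext k h -> kpow_chain k (h \o u : {linear X -> F}, [set x | u x = 0]).
Proof.
move=> uS [hS [g [g' gK gK']]].
split=> [y|] /=.
  by have [z <-] := hS y; have [x <-] := uS z; exists x.
have [w wE] : exists w : {linear kermod (h \o u : {linear X -> F}) -> kermod h}, forall x, val (w x) = u (val x).
  exact: kernel_map.
exists (g \o w : {linear _ -> _}); split=> [y|].
  have [x ux] := uS (val (g' y)).
  have [|z zx] := @kernel_ex _ _ _ (h \o u : {linear X -> F}) x; first by rewrite /= ux kernelP.
  by exists z; rewrite /= -[RHS]gK'; congr (g _); apply: val_inj; rewrite wE zx.
apply/seteqP; split=> x /=.
  move=> ux; have [|z zx] := @kernel_ex _ _ _ (h \o u : {linear X -> F}) x; first by rewrite /= ux linear0.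
  exists z => //; rewrite /= (_ : w z = 0) ?linear0 //.
  by apply: val_inj; rewrite wE zx ux linear0.
move=> [z <-] gz; rewrite -wE; have := congr1 g' gz.
by rewrite gK -(linear0 g) gK => ->; rewrite linear0.
Qed.

(** As [f] kills L = ker u, it descends to [h], and ker h is ker f / L. *)
Lemma kpow_chain_factor X N F k (f : {linear X -> F}) L (u : {linear X -> N}) :
  kpow_chain k (f, L) -> Sur X N u -> (forall x, L x <-> u x = 0) ->
  exists h : {linear N -> F}, (forall x, h (u x) = f x) /\ kpow_ext k h.
Proof.
move=> [/= fS [g [gS LE]]] uS Lu.
have [|h hE] := @linear_factor _ _ _ _ u f uS.
  by move=> x /Lu; rewrite LE => -[y <- _]; exact: kernelP.
exists h; split=> //; split; first by move=> y; have [x <-] := fS y; exists (u x).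
have [w wE] : exists w : {linear kermod f -> kermod h}, forall x, val (w x) = u (val x).
  by apply: kernel_map => x fx; rewrite hE.
have wS y : exists x, w x = y.
  have [x ux] := uS (val y); have [|z zx] := @kernel_ex _ _ _ f x.
    by rewrite -hE ux kernelP.
  by exists z; apply: val_inj; rewrite wE zx.
have [|h' _ h'b] := @surj_ker_iso _ _ _ _ w g wS gS; last by exists h'.
move=> x; rewrite -kpow_sub_ker -LE Lu -wE; split=> [->|e]; first by rewrite linear0.
by apply: val_inj; rewrite e linear0.
Qed.

Definition kpow_chain_via X F k N : set ({linear X -> F} * set X) :=
  [set u | kpow_chain k u /\ exists2 v : {linear X -> N}, Sur X N v & forall x, u.2 x <-> v x = 0].

(** The double count that brings in the moments. A composable pair (u, h) is sent to the chain (h u,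
    ker u). Over a given chain, u ranges over the surjections with that kernel, a torsor under Aut
    N, and h is then determined by u and the composite. *)
Lemma ncard_kpow_chain_via X F k N : finite_set [set: X] -> finite_set [set: F] ->
  finite_set [set: N] ->
  (card_Sur X N * ncard (@kpow_ext F k N))%N = (ncard (@kpow_chain_via X F k N) * card_Sur N N)%N.
Proof.
move=> fX fF fN; rewrite card_SurE -ncard_setX; last 2 first.
- by apply: finite_sub; exact: finite_linear.
- by apply: finite_sub; exact: finite_linear.
have fXF := finite_linear fX fF; have fXN := finite_linear fX fN; have fNF := finite_linear fN fF.
apply: (@ncard_fiber _ _ (fun w : {linear X -> N} * {linear N -> F} =>
  (w.2 \o w.1 : {linear X -> F}, [set x | w.1 x = 0]))).
- by apply: finite_setX; exact: finite_sub.
- apply: finite_sub; rewrite -setXTT; apply: finite_setX => //; exact: finite_sets.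
- move=> [u h] [/= uS hS]; split; first exact: kpow_chain_comp.
  by exists u.
move=> [f L] [ch [u0 u0S /= Lu0]]; rewrite -(sur_same_kernel fN u0S).
have ex (v : {linear X -> N}) : exists h : {linear N -> F}, Sur X N v ->
   (forall x, v x = 0 <-> u0 x = 0) -> (forall x, h (v x) = f x) /\ kpow_ext k h.
  case: (pselect (Sur X N v /\ (forall x, v x = 0 <-> u0 x = 0))) => [[vS vu]|n].
    have [|h hE] := kpow_chain_factor ch vS; last by exists h.
    by move=> x; rewrite vu -Lu0.
  by exists \0 => vS vu; case: n.
have [H HE] := choice ex.
apply: (@ncard_bij _ _ fst (fun v => (v, H v))) => //=.
- move=> [v h] [[/= vS hS] [_ LE]]; split=> // x.
  by rewrite -Lu0 -LE.
- move=> v [vS vu]; have [e hS] := HE v vS vu; split=> //.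
  congr (_, _); first by apply: linear_eq.
  by apply/seteqP; split=> x /=; rewrite Lu0 vu.
- move=> [v h] [[/= vS hS] [fE LE]]; congr (_, _); apply: linear_eq => y.
  have [x <-] := vS y.
  have vu z : v z = 0 <-> u0 z = 0 by rewrite -Lu0 -LE.
  by have [-> _] := HE v vS vu; rewrite -fE.
Qed.

(** The chains are sorted by the isomorphism class of X/L, which is again killed by pi^a and an
    extension of F by kappa^k. *)
Lemma kpow_chain_sum X F k (I : finType) (P : pred I) (M : I -> lmodType R) a :
  finite_killed pi a X -> finite_set [set: F] ->
  (forall i, P i -> finite_set [set: M i]) ->
  (forall i j, P i -> P j -> lmod_iso (M i) (M j) -> i = j) ->
  (forall N (h : {linear N -> F}), finite_killed pi a N -> kpow_ext k h ->
    exists2 i, P i & lmod_iso N (M i)) ->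
  ncard (@kpow_chain X F k) = (\sum_(i | P i) ncard (@kpow_chain_via X F k (M i)))%N.
Proof.
move=> [fX kX] fF fM uM exM; apply: ncard_cover.
- apply: finite_sub; rewrite -setXTT; apply: finite_setX; last exact: finite_sets.
  exact: finite_linear.
- move=> [f L] ch; have [/= fS [g [gS LE]]] := ch.
  pose Lp : {pred X} := fun x => `[< L x >].
  have Ls : submod_closed Lp.
    rewrite /Lp LE; split; first by apply/asboolP; exists 0; rewrite linear0.
    move=> c _ _ /asboolP[x <- gx] /asboolP[y <- gy]; apply/asboolP.
    by exists (c *: x + y); rewrite !linearP //= gx gy scaler0 addr0.
  have pS := @quotient_proj_surj _ _ _ Ls.
  have Lpr x : L x <-> quotient_proj Ls x = 0.
    by rewrite quotient_proj_eq0; split=> /asboolP.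
  have [h [hE hS]] := kpow_chain_factor ch pS Lpr.
  have [|i Pi iso] := exM _ h _ hS.
    split; first exact: finite_surj fX pS.
    by move=> y; have [x <-] := pS y; rewrite -linearZ kX linear0.
  exists i => //; split=> //; have [v [v' [vK v'K]]] := lmod_isoP iso.
  exists (v \o quotient_proj Ls : {linear X -> M i}) => [y|x].
    by have [x px] := pS (v' y); exists x; rewrite -[LHS]/(v (quotient_proj Ls x)) px v'K.
  rewrite /= Lpr -[X in _ <-> X = 0]/(v (quotient_proj Ls x)).
  by split=> [->|e]; [rewrite linear0|rewrite -[LHS]vK e linear0].
- by move=> i x _ [].
move=> i j [f L] Pi Pj [_ [u uS Lu]] [_ [v vS Lv]]; apply: uM => //.
have [|h _ hb] := @surj_ker_iso _ _ _ _ u v uS vS; last by exists h.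
by move=> x; rewrite -Lu -Lv.
Qed.

Lemma kpow_chain_fiber X F k : finite_set [set: X] -> finite_set [set: F] ->
  ncard (@kpow_chain X F k) = (\sum_(f <- fset_set (Sur X F)) ncard (kpow_sub k f))%N.
Proof.
move=> fX fF; have fXF := finite_linear fX fF.
rewrite (@ncard_fiber_sum _ _ fst _ (Sur X F)).
- apply: eq_big_seq => f; rewrite in_fset_set ?inE => [fS|]; last exact: finite_sub.
  apply: (@ncard_bij _ _ snd (fun L => (f, L))) => //=.
  + by move=> [f' L] [[_ /= h] <-].
  + by move=> [f' L] /= [_ <-].
- by apply: finite_sub; rewrite -setXTT; apply: finite_setX => //; exact: finite_sets.
- exact: finite_sub.
- by move=> [f L] [].
Qed.

(** With a trivial socle multiplication by pi is injective, and hence so is that by pi^a, which is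
    zero. *)
Lemma killed_soc0 a N : (forall x : N, pi ^+ a *: x = 0) -> finite_set [set: N] ->
  soc_card pi N = 1%N -> forall x : N, x = 0.
Proof.
move=> kN fN s1 x.
have s0 (y : N) : pi *: y = 0 -> y = 0.
  move=> py; apply: contrapT => y0.
  have : (2 <= soc_card pi N)%N.
    rewrite (_ : 2%N = ncard ([set (0 : N)] `|` [set y])).
      by apply: subset_ncard => [|z [->|->]] //=; [exact: finite_sub|rewrite scaler0].
    by rewrite ncard_setU ?ncard_set1 // => z -> /esym.
  by rewrite s1.
have {kN} := kN x; elim: a => [|a IH]; first by rewrite expr0 scale1r.
by rewrite exprS -scalerA => /s0.
Qed.

(** Hom(ker f, kappa) has the order of the socle of ker f, so it is trivial only for ker f = 0. The
    surjections counted are thus the isomorphisms, a torsor under Aut F if there are any. *)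
Lemma ncard_bijections X F a : finite_killed pi a X -> finite_set [set: F] ->
  ncard [set f | Sur X F f /\ nhom (kermod f) kappa = 1%N] =
  (if `[< lmod_iso X F >] then card_Sur F F else 0)%N.
Proof.
move=> [fX kX] fF.
have triv f : nhom (kermod f) kappa = 1%N <-> (forall x : X, f x = 0 -> x = 0) :> Prop.
  have fk := finite_kermod f fX; split=> [|h].
    rewrite nhom_soc // => /(@killed_soc0 a _) h x fx.
    have [y yx] := kernel_ex fx; rewrite -yx (h _ fk y) // => z.
    by apply: val_inj; rewrite linearZ /= kX.
  rewrite nhom_soc // /soc_card -(ncard_set1 (0 : kermod f)); congr ncard.
  apply/seteqP; split=> [x _|_ -> /=]; last by rewrite scaler0.
  by apply: val_inj; rewrite (h _ (kernelP x)).
case: asboolP => [/lmod_isoP[f [g [fK gK]]]|niso].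
  have fS : Sur X F f by move=> y; exists (g y).
  rewrite -(sur_same_kernel fF fS); congr ncard.
  have f0 x : f x = 0 -> x = 0 by move=> fx; rewrite -(fK x) fx linear0.
  apply/seteqP; split=> v [vS].
    move=> /triv v0; split=> // x.
    by split=> [/v0 ->|/f0 ->]; rewrite linear0.
  by move=> vf; split=> //; apply/triv => x /vf /f0.
set S := [set f | _]; suff -> : S = set0 by rewrite /ncard fset_set0.
by rewrite -subset0 => f [fS /triv f0]; apply: niso; exact: inj_surj_iso f0 fS.
Qed.

End Chains.

(** * Truncated Moebius inversion *)

Section Bonferroni.
Variables (U : realFieldType) (Q : U).
Hypothesis Q1 : 1 < Q.

Let Q0 : 0 < Q. Proof. exact: lt_trans ltr01 Q1. Qed.
Let QX1 i : 0 < Q ^+ i.+1 - 1. Proof. by rewrite subr_gt0 exprn_egt1. Qed.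

(** The weight [q^(k(k-1)/2)] times the number of subspaces of codimension [k]
    in a space of dimension [r] over a field with [q] elements. *)
Definition mobius_term r k : U := \prod_(i < k) ((Q ^+ r - Q ^+ i) / (Q ^+ i.+1 - 1)).

Lemma mobius_term_eq0 r k : (r < k)%N -> mobius_term r k = 0.
Proof.
by move=> rk; rewrite /mobius_term (bigD1 (Ordinal rk)) //= subrr mul0r mul0r.
Qed.

Lemma mobius_term_ge0 r k : 0 <= mobius_term r k.
Proof.
have [/mobius_term_eq0 -> //|kr] := ltnP r k.
apply: prodr_ge0 => i _; apply: divr_ge0; last exact: ltW.
rewrite subr_ge0.
by apply: ler_weXn2l; [exact: ltW|exact: leq_trans (ltnW (ltn_ord i)) kr].
Qed.

(** For r >= 1, this is Q^(m(m+1)/2) times the Gaussian binomial coefficient of r - 1 over m. *)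
Let S r m : U := \prod_(i < m) ((Q ^+ r - Q ^+ i.+1) / (Q ^+ i.+1 - 1)).

Let mobius_termS r m : mobius_term r m.+1 = S r m * ((Q ^+ r - 1) / (Q ^+ m.+1 - 1)).
Proof.
rewrite /mobius_term /S !prodf_div big_ord_recl /= [in X in _ / X]big_ord_recr /=.
rewrite expr0 invfM (eq_bigr (fun i : 'I_m => Q ^+ r - Q ^+ i.+1)) //.
set A := \prod_(i < m) _; set B := \prod_(i < m) _.
by rewrite [_ * A]mulrC mulrACA.
Qed.

(** Telescoping: the next term minus S(r, m) is S(r, m) ((Q^r - 1)/(Q^(m+1) - 1) - 1) = S(r,
    m+1). *)
Let sumS r m : \sum_(k < m.+1) (-1) ^+ k * mobius_term r k = (-1) ^+ m * S r m.
Proof.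
elim: m => [|m IH]; first by rewrite big_ord1 /mobius_term /S !big_ord0.
rewrite big_ord_recr /= IH mobius_termS /S [in RHS]big_ord_recr /= exprS.
set P := \prod_(i < m) _; field.
by rewrite gt_eqF.
Qed.

(** For r = 0 only the term k = 0 is nonzero. For r >= 1 the partial sum up to m - 1 is S(r, m-1) up
    to sign. It vanishes if m > r; otherwise the m-th term is S(r, m-1) times (Q^r - 1)/(Q^m - 1) >=
    1. *)
Lemma bonferroni r m :
  `| (r == 0)%:R - \sum_(k < m) (-1) ^+ k * mobius_term r k | <= mobius_term r m.
Proof.
case: m => [|m].
  by rewrite big_ord0 subr0 /mobius_term big_ord0; case: (r == 0); rewrite ?normr1 ?normr0.
rewrite sumS; case: r => [|r] /=.
  case: m => [|m]; first by rewrite /S big_ord0 mul1r subrr normr0 mobius_term_ge0.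
  rewrite -sumS big_ord_recl big1 => [|i _]; last by rewrite mobius_term_eq0 ?mulr0.
  by rewrite /mobius_term big_ord0 mul1r addr0 subrr normr0 mobius_term_ge0.
rewrite sub0r normrN normrM normrX normrN1 expr1n mul1r mobius_termS.
have [rm|mr] := leqP r.+1 m.
  by rewrite /S (bigD1 (Ordinal rm)) //= subrr !mul0r normr0.
have S0 : 0 <= S r.+1 m.
  apply: prodr_ge0 => i _; apply: divr_ge0; last exact: ltW.
rewrite subr_ge0.
  by apply: ler_weXn2l; [exact: ltW|exact: leq_trans (ltn_ord i) (ltnW mr)].
rewrite ger0_norm // ler_peMr // ler_pdivlMr // mul1r lerD2r.
by apply: ler_weXn2l; [exact: ltW|].
Qed.

(** For a field with Q elements, the proportion of invertible matrices among those of size k. *)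
Definition euler_prod k : U := \prod_(i < k) (1 - Q ^- i.+1).

Lemma prod_expr_sub k : \prod_(i < k) (Q ^+ k - Q ^+ i) = Q ^+ (k ^ 2) * euler_prod k.
Proof.
rewrite (reindex_inj rev_ord_inj) /=.
have -> : Q ^+ (k ^ 2) = \prod_(i < k) Q ^+ k by rewrite prodr_const card_ord -exprM.
rewrite -big_split /=; apply: eq_bigr => i _.
by rewrite mulrBr mulr1 -exprB ?unitfE ?gt_eqF.
Qed.

Lemma prod_expr_sub_bin k :
  \prod_(i < k) (Q ^+ k - Q ^+ i) = Q ^+ 'C(k, 2) * \prod_(i < k) (Q ^+ i.+1 - 1).
Proof.
rewrite [in RHS](reindex_inj rev_ord_inj) /= -bin2_sum big_mkord -prodrXr -big_split /=.
apply: eq_bigr => i _; rewrite mulrBr mulr1 -exprD; congr (Q ^+ _ - _).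
by rewrite -subSn // subSS subnKC // ltnW.
Qed.

(** The induction carries the stronger bound 1/4 + 2^-(k+1) for k >= 1, an equality for k = 1 and Q
    = 2. Its step is (1/4 + z)(1 - z) >= 1/4 + z/2, valid for 0 <= z <= 1/4. *)
Lemma euler_prod_ge k : 2 <= Q -> 4^-1 <= euler_prod k.
Proof.
move=> Q2; suff h j : 4^-1 + 2 ^- j.+2 <= euler_prod j.+1.
  case: k => [|k]; first by rewrite /euler_prod big_ord0; lra.
  by apply: le_trans (h k); rewrite lerDl invr_ge0 exprn_ge0.
elim: j => [|j IH].
  rewrite /euler_prod big_ord1 expr1.
  have : Q^-1 <= 2^-1 by rewrite lef_pV2 // posrE.
  lra.
rewrite /euler_prod big_ord_recr /= -/(euler_prod j.+1).
set e := euler_prod _ in IH *.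
have h1 : Q ^- j.+2 <= 2 ^- j.+2.
  by rewrite lef_pV2 ?posrE ?exprn_gt0 // lerXn2r // nnegrE ltW.
have h2 : 2 ^- j.+2 <= 4^-1 :> U.
  rewrite lef_pV2 ?posrE ?exprn_gt0 //.
  by rewrite (_ : 4 = 2 ^+ 2); [apply: ler_weXn2l => //; lra|rewrite expr2; lra].
have h3 : 2 ^- j.+3 = 2 ^- j.+2 / 2 :> U by rewrite exprS invfM mulrC.
have h4 : 0 < 2 ^- j.+2 :> U by rewrite invr_gt0 exprn_gt0.
rewrite h3; set z := 2 ^- j.+2 in h1 h2 h3 h4 IH *.
apply: (@le_trans _ _ ((4^-1 + z) * (1 - z))); first by nra.
by apply: ler_pM => //; lra.
Qed.

End Bonferroni.

(** * Decay of the inversion coefficients *)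

Section Estimates.
Variables (R : idomainType) (pi : R).
Hypothesis pi_unif : uniformizer pi.
Hypothesis kfin : finite_set [set: cyclic_module pi].
Implicit Types (M N G X Y F : lmodType R) (k : nat).
Local Notation kappa := (cyclic_module pi).
Local Notation q := (rcard pi).
Local Notation kpow := (kpow pi).

(** A surjection h, together with an automorphism b of kappa^k, gives an embedding w of kappa^k with
    image ker h, and Hom(kappa^k, N) has #N[pi]^k elements. Given w, the kernel of h is known,
    leaving #Aut F choices of h, and b is then determined. *)
Lemma kpow_ext_bound F k N : finite_set [set: F] -> finite_set [set: N] ->
  (ncard (@kpow_ext _ pi F k N) * card_Sur (kpow k) (kpow k) <=
   card_Sur F F * soc_card pi N ^ k)%N.
Proof.
move=> fF fN; have fk : finite_set [set: kpow k] by apply: finite_addk => //; exact: finite_Z.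
have fNF := finite_linear fN fF; have fkk := finite_linear fk fk.
have fkN := finite_linear fk fN.
have -> : (soc_card pi N ^ k)%N = nhom (kpow k) N.
  by rewrite nhom_addk_l ?nhom_Z ?mul1n //; exact: finite_Z.
rewrite card_SurE -ncard_setX; [|exact: finite_sub..].
rewrite mulnC.
(* [j h] is a chosen isomorphism of kappa^k onto ker h, viewed in N. *)
have ex (h : {linear N -> F}) : exists j : {linear kpow k -> N}, kpow_ext pi k h ->
    (forall x, j x = 0 -> x = 0) /\ (forall y, h y = 0 <-> exists x, j x = y).
  case: (pselect (kpow_ext pi k h)) => [[hS gb]|n]; last by exists \0.
  have [g' gi] : lmod_iso (kpow k) (kermod h) by apply: lmod_iso_sym; case: gb => g gb; exists g.
  have jl : linear (fun x => val (g' x)) by move=> c x y; rewrite !linearP.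
  exists (mk_linear jl) => _; split=> [x|y].
    by rewrite mk_linearE -(linear0 (val : {linear kermod h -> N})) => /val_inj;
       rewrite -(linear0 g') => /(bij_inj gi).
  split=> [hy|[x <-]]; last exact: kernelP.
  have [z zy] := kernel_ex hy; case: gi => g _ gK; exists (g z).
  by rewrite mk_linearE gK.
have [j jE] := choice ex.
apply: (@leq_ncard_fiber _ _ (fun u : {linear N -> F} * {linear kpow k -> kpow k} =>
   j u.1 \o u.2 : {linear kpow k -> N})) => //.
  by apply: finite_setX; exact: finite_sub.
move=> w _.
case: (pselect (exists h b, [/\ kpow_ext pi k h, Sur (kpow k) (kpow k) b &
  (j h \o b : {linear kpow k -> N}) = w])); last first.
  move=> nex; set S := [set _ | _]; suff -> : S = set0 by rewrite /ncard fset_set0.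
  by rewrite -subset0 => -[h b] [[/= hS bS] e]; apply: nex; exists h, b.
move=> [h0 [b0 [h0S b0S e0]]].
rewrite -(sur_same_kernel fF (proj1 h0S)).
apply: (@leq_ncard_inj _ _ fst); first exact: finite_sub.
  move=> [h b] [h' b']; rewrite !inE => -[[/= hS bS] e] [[/= _ b'S] e'] hh'.
  rewrite -hh' in e' *; congr (_, _); apply: linear_eq => x.
  apply/eqP; rewrite -subr_eq0; apply/eqP/(proj1 (jE h hS)).
  have : (j h \o b : {linear kpow k -> N}) x = (j h \o b' : {linear kpow k -> N}) x by rewrite e e'.
  by rewrite linearB /= => ->; rewrite subrr.
move=> [h b] [[/= hS bS] e]; split; first exact: (proj1 hS).
have im (h1 : {linear N -> F}) (b1 : {linear kpow k -> kpow k}) :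
    kpow_ext pi k h1 -> Sur (kpow k) (kpow k) b1 ->
    (j h1 \o b1 : {linear kpow k -> N}) = w ->
    forall y, h1 y = 0 <-> exists x, w x = y.
  move=> h1S b1S <- y; rewrite (proj2 (jE h1 h1S) y); split=> -[x xy]; last by exists (b1 x).
  by have [z zx] := b1S x; exists z; rewrite /= zx.
by move=> y; rewrite (im h b) // (im h0 b0).
Qed.

(** The identity of G plus any homomorphism kappa^m -> G is onto, and there are #G[pi]^m of the
    latter. *)
Lemma sur_addk_self_ge G m : finite_set [set: G] ->
  (soc_card pi G ^ m <= card_Sur (addk pi G m) G)%N.
Proof.
move=> fG; elim: m => [|m IH].
  rewrite expn0; apply: (@ncard_gt0 _ _ (idfun : {linear G -> G})).
    by apply: finite_sub; exact: finite_linear.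
  by move=> y; exists y.
have fm := finite_addk kfin m fG.
apply: (@leq_trans (card_Sur (addk pi G m) G * nhom kappa G)).
  by rewrite expnSr nhom_kappa leq_mul2r IH orbT.
have f1 := finite_linear fm fG; have f2 := finite_linear kfin fG.
rewrite card_SurE /nhom -ncard_setX; [|exact: finite_sub..].
have l (u : {linear addk pi G m -> G} * {linear kappa -> G}) :
    linear (fun x : addk pi G m.+1 => u.1 x.1 + u.2 x.2).
  by move=> c x y /=; rewrite !linearP /= scalerDr addrACA.
apply: (@leq_ncard_inj _ _ (fun u => mk_linear (l u))).
- by apply: finite_sub; apply: finite_linear => //; exact: (finite_addk kfin m.+1 fG).
- move=> [f g] [f' g'] _ _ e.
  have e' (x : addk pi G m.+1) : f x.1 + g x.2 = f' x.1 + g' x.2.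
    by have := congr1 (fun h : {linear addk pi G m.+1 -> G} => h x) e.
  congr (_, _); apply: linear_eq => x.
    by have := e' (x, 0); rewrite /= !linear0 !addr0.
  by have := e' (0, x); rewrite /= !linear0 !add0r.
- move=> [f g] [/= fS _] y; have [x fx] := fS y.
  by exists (x, 0); rewrite mk_linearE /= fx linear0 addr0.
Qed.

Lemma kpow_ext_ncard F k N (h : {linear N -> F}) : finite_set [set: N] -> kpow_ext pi k h ->
  ncard [set: N] = (ncard [set: F] * q ^ k)%N.
Proof.
move=> fN [hS [g gb]]; rewrite (ncard_surj_kernel fN hS); congr (_ * _)%N.
rewrite -ncard_kpow // -(@iso_ncard _ (kermod h)); last by exists g.
rewrite -(@ncard_image _ _ (val : kermod h -> N)); last by move=> x y _ _ /val_inj.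
congr ncard; apply/seteqP; split=> [x hx|_ [y _ <-]]; last exact: kernelP.
by have [y yx] := kernel_ex hx; exists y.
Qed.

(** The kernel lies in the socle, so #N[pi] >= q^k, while #N[pi] #(pi N) = #N = #F q^k. *)
Lemma kpow_ext_rad F k N (h : {linear N -> F}) : finite_set [set: N] -> kpow_ext pi k h ->
  (rad_card pi N <= ncard [set: F])%N.
Proof.
move=> fN hS; have e := kpow_ext_ncard fN hS; have [_ [g [g' gK g'K]]] := hS.
have qs : (q ^ k <= soc_card pi N)%N.
  rewrite -ncard_kpow //; apply: (@leq_ncard_inj _ _ (fun x => val (g' x))).
  - exact: finite_sub.
  - by move=> x y _ _ /val_inj /(can_inj g'K).
  - move=> x _ /=; have e0 : pi *: g' x = 0.
      by apply: (can_inj gK); rewrite linearZ /= g'K kpow_kill linear0.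
    exact: (congr1 val e0).
have := soc_rad pi fN; rewrite e => e'.
rewrite -(@leq_pmul2r (q ^ k)) ?expn_gt0 ?(ltnW (rcard_gt1 pi_unif kfin)) // e'.
by rewrite leq_mul2l qs orbT.
Qed.

Hypothesis pi_neq0 : pi != 0.

(** First digit and remainder: (u, v) goes to s(u) + pi v for a choice [s] of representatives. This
    is a bijection of sets only, which suffices to count. *)
Lemma cyc_pow_step k : exists f : kappa * cyclic_module (pi ^+ k) -> cyclic_module (pi ^+ k.+1),
  bijective f.
Proof.
have sex (u : kappa) : exists c, c *: cyc1 pi = u by have [c ->] := cyc_ex u; exists c.
have [s sE] := choice sex.
have [|m mE] := @cyc_map _ (pi ^+ k) _ (pi *: cyc1 (pi ^+ k.+1)).
  by rewrite scalerA -exprSr cyc_kill.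
pose f (w : kappa * cyclic_module (pi ^+ k)) := s w.1 *: cyc1 (pi ^+ k.+1) + m w.2.
have fS y : exists w, f w = y.
  have [c ->] := cyc_ex y; have : (c - s (c *: cyc1 pi)) *: cyc1 pi = 0.
    by rewrite scalerBl sE subrr.
  move=> /cyc_eq0[d dE]; exists (c *: cyc1 pi, d *: cyc1 (pi ^+ k)).
  by rewrite /f linearZ /= mE scalerA -scalerDl -dE addrC subrK.
have fI : injective f.
  move=> [u v] [u' v']; have [d ->] := cyc_ex v; have [d' ->] := cyc_ex v'.
  rewrite /f /= !linearZ /= mE !scalerA -!scalerDl => /eqP.
  rewrite -subr_eq0 -scalerBl => /eqP/cyc_eq0[e eE].
  have uu' : u = u'.
    rewrite -(sE u) -(sE u'); apply/eqP; rewrite -subr_eq0 -scalerBl; apply/eqP/cyc_eq0.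
    exists (e * pi ^+ k - d + d'); rewrite !mulrDl mulNr -mulrA -exprSr -eE.
    by ring.
  rewrite -uu' in eE *; congr (_, _).
  apply/eqP; rewrite -subr_eq0 -scalerBl; apply/eqP/cyc_eq0; exists e.
  apply: (mulIf pi_neq0); rewrite -mulrA -exprSr -eE; ring.
have [g gE] := choice fS.
by exists f, g => // w; apply: fI; rewrite gE.
Qed.

Lemma finite_cyc_pow k : finite_set [set: cyclic_module (pi ^+ k)].
Proof.
elim: k => [|k IH]; first by rewrite expr0; exact: finite_Z.
have [f [g fK gK]] := cyc_pow_step k.
have : finite_set [set: kappa * cyclic_module (pi ^+ k)] by exact: finite_prod.
by move=> /finite_surj; apply=> y; exists (g y).
Qed.

Lemma ncard_cyc_pow k : ncard [set: cyclic_module (pi ^+ k)] = (q ^ k)%N.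
Proof.
elim: k => [|k IH]; first by rewrite expr0 ncard_Z.
have [f [g fK gK]] := cyc_pow_step k.
rewrite -(@ncard_bij _ _ f g [set: kappa * cyclic_module (pi ^+ k)]) //.
by rewrite -setXTT ncard_setX ?IH ?expnS //; exact: finite_cyc_pow.
Qed.

(** By duality it is enough to count Hom(R/pi^(k+1), kappa), where the generator may go anywhere. *)
Lemma soc_cyc_pow k : soc_card pi (cyclic_module (pi ^+ k.+1)) = q.
Proof.
rewrite -nhom_soc //; last exact: finite_cyc_pow.
have ex (x : kappa) : exists f : {linear cyclic_module (pi ^+ k.+1) -> kappa}, f (cyc1 _) = x.
  by apply: cyc_map; rewrite exprS mulrC -scalerA cyc_kill scaler0.
have [g gE] := choice ex.
apply: (@ncard_bij _ _ (fun f : {linear _ -> kappa} => f (cyc1 _)) g) => // f _.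
by apply: cyc_linear_eq; rewrite gE.
Qed.

Lemma finite_partition_module l : finite_set [set: partition_module pi l].
Proof. by elim: l => [|k l IH]; [exact: finite_Z|apply: finite_prod => //; exact: finite_cyc_pow]. Qed.

Lemma ncard_partition_module l : ncard [set: partition_module pi l] = (q ^ sumn l)%N.
Proof.
elim: l => [|k l IH]; first exact: ncard_Z.
rewrite -setXTT ncard_setX; [|exact: finite_cyc_pow|exact: finite_partition_module].
by rewrite IH ncard_cyc_pow expnD.
Qed.

Lemma soc_partition_module l : all (leq 1) l ->
  soc_card pi (partition_module pi l) = (q ^ size l)%N.
Proof.
elim: l => [_|[|k] l IH] //=.
  by apply: etrans (ncard_Z R); congr ncard; apply/seteqP; split=> // x _; exact: cyc_0.
move=> /IH e; rewrite expnS -e -(soc_cyc_pow k).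
rewrite -ncard_setX; last 2 first.
- by apply: finite_sub; exact: finite_cyc_pow.
- by apply: finite_sub; exact: finite_partition_module.
by congr ncard; apply/seteqP; split=> [[x y] [ex ey]|[x y] [/= ex ey]] //=; congr (_, _).
Qed.

Lemma leq_sum_sqr (I : Type) (s : seq I) (f : I -> nat) :
  (\sum_(i <- s) f i ^ 2 <= (\sum_(i <- s) f i) ^ 2)%N.
Proof.
elim: s => [|i s IH]; first by rewrite !big_nil.
by rewrite !big_cons sqrnD (leq_trans _ (leq_addr _ _)) // leq_add2l.
Qed.

(** Both sides count the cells of the diagram; the columns beyond the largest part are empty. *)
Lemma sum_conj_part (l : seq nat) H : all (geq H) l ->
  (\sum_(1 <= j < H.+1) conj_part l j)%N = sumn l.
Proof.
elim: l => [|x l IH] /=; first by rewrite big1.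
move=> /andP[xH /IH <-]; rewrite big_split /=; congr (_ + _)%N.
rewrite (big_cat_nat (n := x.+1)) //=.
rewrite (eq_big_nat _ _ (F2 := fun=> 1%N)) => [|j /andP[_ jx]]; last by rewrite -ltnS jx.
rewrite sum_nat_const_nat subSS subn0 muln1 big_nat big1 ?addn0 // => j /andP[xj _].
by rewrite leqNgt xj.
Qed.

(** The first column of the type of N has length r. The other columns add up to log_q #(pi N), which
    is at most #(pi N), and the sum of their squares is at most the square of their sum. The crude
    second term is harmless, as #(pi N) <= #F for the extensions of F. *)
Lemma moment_weight_le (U : realType) N r : finite_set [set: N] ->
  soc_card pi N = (q ^ r)%N ->
  moment_weight pi N U <= q%:R `^ ((r ^ 2 + rad_card pi N ^ 2)%:R / 2).
Proof.
move=> fN sN; have q1 := rcard_gt1 pi_unif kfin.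
rewrite /moment_weight -[residue_card pi]/q; set l := module_type pi N.
apply: ler_powR; first by rewrite ler1n ltnW.
(* Any partition describing [N] will do; if there were none, [module_type]
   would be empty and the weight equal to [1]. *)
have [l0|[/andP[lsort lpos] iso]] : l = [::] \/ is_partition l /\ lmod_iso N (partition_module pi l).
    by rewrite /l /module_type; case: xgetP => [x -> []|]; [right|left].
  by rewrite l0 big_geq // divr_ge0.
have lr : size l = r.
  apply/eqP; rewrite -(eqn_exp2l _ _ q1) -soc_partition_module // -sN.
  by apply/eqP/esym/iso_soc.
have lrad : (sumn l - size l <= rad_card pi N)%N.
  apply: leq_trans (ltnW (ltn_rcardX pi_unif kfin _)) _.
  have := soc_rad pi fN; rewrite (iso_ncard iso) ncard_partition_module sN -lr.
  have ls : (size l <= sumn l)%N.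
    by move: lpos; elim: (l) => //= x s IH /andP[x1 /IH]; exact: leq_add x1.
  rewrite -{1}(subnK ls) expnD => /eqP.
  by rewrite eqn_pmul2r ?expn_gt0 ?(ltnW q1) // => /eqP ->.
have lH : all (geq (head 0%N l)) l.
  case: (l) lsort => //= x s; rewrite leqnn /=.
  by rewrite (path_sortedE (rev_trans leq_trans)) => /andP[].
have := sum_conj_part lH; case: (l) lr lrad lpos => [|[|x] s] lr lrad lpos //= ls.
  by rewrite big_geq // divr_ge0.
rewrite -mulr_suml ler_wpM2r ?invr_ge0 //.
under eq_bigr do rewrite -natrX.
rewrite -natr_sum ler_nat big_nat_recl //=.
(* All parts being positive, the first column meets every one of them. *)
have s1 : (1 + conj_part s 1)%N = r.
  by rewrite -lr /conj_part; move: lpos; rewrite /= all_count => /eqP ->.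
move: ls; rewrite big_nat_recl //= s1 => ls.
rewrite leq_add2l (leq_trans (leq_sum_sqr _ _)) // leq_sqr (leq_trans _ lrad) //.
by rewrite -lr /= in ls *; rewrite -ls addKn.
Qed.

End Estimates.

(** * Inversion coefficients against the moment weight *)

Section Tail.
Variables (R : idomainType) (pi : R).
Hypothesis pi_unif : uniformizer pi.
Hypothesis kfin : finite_set [set: cyclic_module pi].
Variable U : realType.
Implicit Types (M N G X Y F : lmodType R) (k : nat).
Local Notation kappa := (cyclic_module pi).
Local Notation q := (rcard pi).
Local Notation kpow := (kpow pi).
Local Notation Q := (q%:R : U).

Let q1 : (1 < q)%N := rcard_gt1 pi_unif kfin.
Let Q1 : 1 < Q. Proof. by rewrite ltr1n. Qed.
Let Q2 : 2 <= Q. Proof. by rewrite ler_nat. Qed.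
Let Q0 : 0 < Q. Proof. exact: lt_trans ltr01 Q1. Qed.

(** Truncated subtraction does no harm: if r < k, the factor i = r is zero on both sides. *)
Lemma natr_prod_sub r k :
  (\prod_(i < k) (q ^ r - q ^ i))%N%:R = \prod_(i < k) (Q ^+ r - Q ^+ i).
Proof.
have [rk|kr] := ltnP r k.
  by rewrite (bigD1 (Ordinal rk)) // [RHS](bigD1 (Ordinal rk)) //= subnn subrr !mul0r.
rewrite natr_prod; apply: eq_bigr => i _; rewrite natrB ?natrX //.
by rewrite leq_exp2l // (leq_trans (ltnW (ltn_ord i)) kr).
Qed.

Lemma finite_kpow k : finite_set [set: kpow k].
Proof. by apply: finite_addk => //; exact: finite_Z. Qed.

Lemma natr_sur_kpow k :
  (card_Sur (kpow k) (kpow k))%:R = Q ^+ (k ^ 2) * euler_prod Q k.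
Proof.
rewrite sur_kpow //; last exact: finite_kpow.
rewrite nhom_addk //; last exact: finite_Z.
by rewrite nhom_Z mul1n natr_prod_sub prod_expr_sub.
Qed.

(** The number of submodules is the product of the q^r - q^i divided by #Aut(kappa^k), whose factor
    q^(k(k-1)/2) cancels the Moebius weight. *)
Lemma mobius_termE X F k (f : {linear X -> F}) r : finite_set [set: X] ->
  nhom (kermod f) kappa = (q ^ r)%N ->
  Q ^+ 'C(k, 2) * (ncard (kpow_sub pi k f))%:R = mobius_term Q r k.
Proof.
move=> fX fr; have := congr1 (fun n => n%:R : U) (ncard_kpow_sub kfin k f fX).
have fk := finite_kpow k; have fK := finite_kermod f fX.
rewrite natrM !sur_kpow //.
rewrite fr nhom_addk ?nhom_Z ?mul1n //; last exact: finite_Z.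
rewrite !natr_prod_sub prod_expr_sub_bin // /mobius_term prodf_div => <-.
rewrite mulrCA mulrA mulfK // prodf_seq_neq0.
by apply/allP => i _; rewrite subr_eq0 gt_eqF // exprn_egt1.
Qed.

(** For finite X, the sum of the k-th Moebius terms of the kernels of all surjections X -> F. *)
Definition chain_weight X F k : U := Q ^+ 'C(k, 2) * (ncard (@kpow_chain _ pi X F k))%:R.

(** The Bonferroni bound is summed over the surjections f; those with kernel of rank 0 are the
    isomorphisms. *)
Lemma iso_indicator_bound X F a m : finite_killed pi a X -> finite_set [set: F] ->
  `| (if `[< lmod_iso X F >] then card_Sur F F else 0)%N%:R
     - \sum_(k < m) (-1) ^+ k * chain_weight X F k | <= chain_weight X F m.
Proof.
move=> kX fF; have fX := proj1 kX.
have [r rE] : exists r : {linear X -> F} -> nat, forall f, nhom (kermod f) kappa = (q ^ r f)%N.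
  have ex (f : {linear X -> F}) : exists r, nhom (kermod f) kappa = (q ^ r)%N.
    by have [r [e _]] := rankP pi_unif kfin (finite_kermod f fX); exists r.
  by have [r rE] := choice ex; exists r.
have cw k : chain_weight X F k = \sum_(f <- fset_set (Sur X F)) mobius_term Q (r f) k.
  rewrite /chain_weight kpow_chain_fiber // natr_sum mulr_sumr.
  by apply: eq_bigr => f _; exact: mobius_termE.
have -> : (if `[< lmod_iso X F >] then card_Sur F F else 0)%N%:R =
    \sum_(f <- fset_set (Sur X F)) (r f == 0%N)%:R :> U.
  rewrite -(ncard_bijections pi_unif kfin kX fF) -natr_sum; congr _%:R.
  rewrite [RHS](eq_bigr (fun f => if r f == 0 then 1 else 0)%N) => [|f _]; last by case: eqP.
  rewrite /ncard card_fset_sum1 -big_mkcond -[RHS]big_filter.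
  apply: perm_big; apply: uniq_perm; rewrite ?filter_uniq ?fset_uniq // => f.
  have fXF := finite_linear fX fF.
  rewrite mem_filter !in_fset_set; [|exact: finite_sub..].
  apply/idP/andP; rewrite !inE /= rE => -[].
    move=> fS /eqP; rewrite -[X in _ == X](expn0 q) eqn_exp2l // => /eqP ->.
  by move=> /eqP -> fS; split.
under [X in _ - X]eq_bigr do rewrite cw mulr_sumr.
rewrite [X in _ - X]exchange_big -sumrB cw /=.
apply: (le_trans (ler_norm_sum _ _ _)); apply: ler_sum => f _.
exact: bonferroni.
Qed.

(** The coefficient of #Sur(X, N) in [chain_weight X F k]. *)
Definition ext_weight F k N : U :=
  Q ^+ 'C(k, 2) * (ncard (@kpow_ext _ pi F k N))%:R / (card_Sur N N)%:R.

Lemma ext_weight_ge0 F k N : 0 <= ext_weight F k N.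
Proof. by rewrite divr_ge0 // mulr_ge0 // exprn_ge0 // ltW. Qed.

Lemma card_Sur_self_gt0 N : finite_set [set: N] -> (0 < card_Sur N N)%N.
Proof.
move=> fN; apply: (@ncard_gt0 _ _ (idfun : {linear N -> N})).
  by apply: finite_sub; exact: finite_linear.
by move=> y; exists y.
Qed.

Lemma chain_weight_sum X F k (I : finType) (P : pred I) (M : I -> lmodType R) a :
  finite_killed pi a X -> finite_set [set: F] ->
  (forall i, P i -> finite_set [set: M i]) ->
  (forall i j, P i -> P j -> lmod_iso (M i) (M j) -> i = j) ->
  (forall N (h : {linear N -> F}), finite_killed pi a N -> kpow_ext pi k h ->
    exists2 i, P i & lmod_iso N (M i)) ->
  chain_weight X F k = \sum_(i | P i) ext_weight F k (M i) * (card_Sur X (M i))%:R.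
Proof.
move=> kX fF fM uM cM; rewrite /chain_weight (kpow_chain_sum kX fF fM uM cM).
rewrite natr_sum mulr_sumr; apply: eq_bigr => i Pi; have fMi := fM i Pi.
have := congr1 (fun n => n%:R : U) (ncard_kpow_chain_via pi k (proj1 kX) fF fMi).
rewrite !natrM => e; rewrite /ext_weight -mulrA -mulrA; congr (_ * _).
rewrite mulrCA mulrC [_ * (card_Sur X _)%:R]mulrC e mulfK // pnatr_eq0.
by rewrite -lt0n card_Sur_self_gt0.
Qed.

Lemma bin2r k : ('C(k, 2))%:R = (k%:R ^+ 2 - k%:R) / 2 :> U.
Proof.
elim: k => [|k IH]; first by rewrite expr0n /= subrr mul0r.
by rewrite binS bin1 natrD IH -natr1; field.
Qed.

Lemma iso_rad M N : lmod_iso M N -> rad_card pi M = rad_card pi N.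
Proof.
move=> /lmod_isoP[f [g [fK gK]]]; apply: (@ncard_bij _ _ f g) => //.
  by move=> _ [x _ <-]; exists (f x); rewrite ?linearZ.
by move=> _ [x _ <-]; exists (g x); rewrite ?linearZ.
Qed.

(** Here N = N' + kappa^m has rank m + r with r <= c = #F, so the terms in r alone go into the
    constant. The factor 16 comes from bounding two Euler products below by 1/4, one in
    #Aut(kappa^k) and one in #Aut N. *)
Lemma ext_weight_tail F k N a (h : {linear N -> F}) : pi != 0 ->
  finite_set [set: F] -> finite_killed pi a N -> kpow_ext pi k h ->
  ext_weight F k N * moment_weight pi N U <=
  16 * (card_Sur F F)%:R * Q `^ (2 * (ncard [set: F])%:R ^+ 2) * (Q `^ (- 2^-1)) ^+ k.
Proof.
move=> pi0 fF kN hS; have fN := proj1 kN; set c := ncard [set: F].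
have [m [N' [iso kN' sr]]] := split_socle pi_unif kfin kN; have fN' := proj1 kN'.
have [r [_ sN']] := rankP pi_unif kfin fN'.
have sN : soc_card pi N = (q ^ (m + r))%N.
  by rewrite (iso_soc pi iso) soc_addk // sN' -expnD addnC.
have radN : rad_card pi N = rad_card pi N' by rewrite (iso_rad iso) rad_addk.
have rc : (rad_card pi N <= c)%N by exact: kpow_ext_rad fN hS.
have r'c : (r <= c)%N.
  apply: leq_trans (ltnW (ltn_rcardX pi_unif kfin r)) _.
  by rewrite -sN' (leq_trans sr) // -radN.
pose E (x : U) := Q `^ x.
have ED x y : E (x + y) = E x * E y by rewrite /E powRD // (gt_eqF Q0) implybT.
have E0 x : 0 < E x by exact: powR_gt0.
have EX n : Q ^+ n = E n%:R by rewrite /E powR_mulrn // ltW.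
have EK x : E (- x) * E x = 1 by rewrite -ED addNr /E powRr0.
have e4 j : 4^-1 <= euler_prod Q j by exact: euler_prod_ge.
(* From [kpow_ext_bound] and #Aut(kappa^k) >= q^(k^2)/4. *)
have nS : (ncard (@kpow_ext _ pi F k N))%:R <= 4 * (card_Sur F F)%:R * E ((m + r)%:R * k%:R - k%:R ^+ 2).
  have := kpow_ext_bound kfin k fF fN; rewrite -(ler_nat U) !natrM natr_sur_kpow sN.
  rewrite -expnM natrX !EX [in (k ^ 2)%:R]natrX natrM ED.
  set x := (ncard _)%:R; set S := (card_Sur F F)%:R.
  have x0 : 0 <= x by [].
  move=> hx; have : x * E (k%:R ^+ 2) * 4^-1 <= S * E ((m + r)%:R * k%:R).
    apply: le_trans hx; rewrite -mulrA; apply: ler_wpM2l => //.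
    by apply: ler_wpM2l; [exact: ltW|].
  rewrite -(ler_pM2r (E0 (- k%:R ^+ 2))) => hx'.
  have -> : x = 4 * (x * E (k%:R ^+ 2) * 4^-1 * E (- k%:R ^+ 2)).
    transitivity (x * (E (- k%:R ^+ 2) * E (k%:R ^+ 2))); first by rewrite EK mulr1.
    by field.
  by rewrite -!mulrA ler_pM2l // !mulrA in hx' *.
(* #Aut N is #Sur(N, N') times the product of the q^(r+m) - q^(r+i) for i < m; these are at least
   q^(rm) and q^(rm) q^(m^2)/4. *)
have aN : E (2 * r%:R * m%:R + m%:R ^+ 2) * 4^-1 <= (card_Sur N N)%:R.
  rewrite (sur_iso_l N iso) (sur_iso_r _ iso) sur_addk //; last exact: finite_addk.
  rewrite !nhom_addk // nhom_soc // sN'.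
  have -> : (\prod_(i < m) (q ^ r * q ^ m - q ^ r * q ^ i) =
     q ^ (r * m) * \prod_(i < m) (q ^ m - q ^ i))%N.
    rewrite expnM (_ : (q ^ r) ^ m = \prod_(i < m) q ^ r)%N; last by rewrite prod_nat_const card_ord.
    rewrite -big_split /=.
    by apply: eq_bigr => i _; rewrite mulnBr.
  rewrite !natrM natr_prod_sub prod_expr_sub // natrX.
  have : (q ^ (r * m))%:R <= (card_Sur (addk pi N' m) N')%:R :> U.
    by rewrite ler_nat expnM -sN'; exact: sur_addk_self_ge.
  rewrite natrX !EX natrX natrM ED => h1.
  have -> : E (2 * r%:R * m%:R) = E (r%:R * m%:R) * E (r%:R * m%:R).
    by rewrite -ED; congr E; ring.
  rewrite -!mulrA; apply: ler_pM => //; first exact: ltW.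
    by rewrite !mulr_ge0 // ltW.
  apply: ler_wpM2l; first exact: ltW.
  by apply: ler_wpM2l; [exact: ltW|].
have w := moment_weight_le pi_unif kfin pi0 U fN sN.
have w0 : 0 <= moment_weight pi N U by exact: powR_ge0.
have cS0 : 0 < (card_Sur N N)%:R :> U by rewrite ltr0n card_Sur_self_gt0.
have iA : (card_Sur N N)%:R^-1 <= 4 * E (- (2 * r%:R * m%:R + m%:R ^+ 2)).
  have -> : 4 * E (- (2 * r%:R * m%:R + m%:R ^+ 2)) = (E (2 * r%:R * m%:R + m%:R ^+ 2) * 4^-1)^-1.
    by rewrite invfM invrK mulrC /E powRN.
  by rewrite lef_pV2 // posrE divr_gt0.
rewrite -[(Q `^ _) ^+ k]powR_mulrn ?powR_ge0 // -powRrM -!/(E _) /ext_weight EX.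
set S := (card_Sur F F)%:R.
apply: (@le_trans _ _ (E 'C(k,2)%:R * (4 * S * E ((m + r)%:R * k%:R - k%:R ^+ 2)) *
   (4 * E (- (2 * r%:R * m%:R + m%:R ^+ 2))) * E (((m + r) ^ 2 + rad_card pi N ^ 2)%:R / 2))).
  apply: ler_pM => //; first by rewrite divr_ge0 // mulr_ge0 // ltW.
  apply: ler_pM => //; first by rewrite mulr_ge0 // ltW.
  by apply: ler_wpM2l => //; exact: ltW.
have -> : forall x y z t : U, E x * (4 * S * E y) * (4 * E z) * E t = 16 * S * E (x + y + z + t).
  by move=> x y z t; rewrite !ED; ring.
rewrite -[X in _ <= X]mulrA -[X in _ <= _ * X]/(E _ * E _) -ED.
apply: ler_wpM2l; first by rewrite mulr_ge0.
apply: ler_powR; first exact: ltW.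
rewrite bin2r !natrD !natrX natrD.
have : (r%:R : U) <= c%:R by rewrite ler_nat.
have : (rad_card pi N)%:R <= c%:R :> U by rewrite ler_nat.
have := ler0n U r; have := ler0n U (rad_card pi N).
set rr : U := r%:R; set mm : U := m%:R; set kk : U := k%:R; set cc : U := c%:R.
set ss : U := (rad_card pi N)%:R.
move=> s0 r0 sc rrc; have h1 : ss ^+ 2 <= cc ^+ 2 by nra.
have h2 : rr ^+ 2 <= cc ^+ 2 by nra.
(* The exponent on the left equals -k/2 - (k - m - r)^2/2 + r^2 + ss^2/2, where r and ss are at most
   c. *)
have := sqr_ge0 (kk - (mm + rr)); nra.
Qed.

End Tail.

(** * Reduction modulo a scalar and tensor products *)

Section Reduction.
Variables (R : comNzRingType) (b : R).
Implicit Types M N V G : lmodType R.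

Definition scaled M : {pred M} := fun x => `[< exists y, x = b *: y >].

Fact scaled_submod M : submod_closed (@scaled M).
Proof.
split; first by apply/asboolP; exists 0; rewrite scaler0.
move=> c _ _ /asboolP[y ->] /asboolP[z ->]; apply/asboolP.
by exists (c *: y + z); rewrite scalerDr !scalerA mulrC.
Qed.

(** M/bM, the concrete model of the tensor product of M with R/bR. *)
Definition reduction M : lmodType R := quotient_module (@scaled_submod M).
Definition reduce M : {linear M -> reduction M} := quotient_proj (@scaled_submod M).

Lemma reduce_surj M (y : reduction M) : exists x, reduce M x = y.
Proof. exact: quotient_proj_surj. Qed.

Lemma reduce_eq0 M (x : M) : reduce M x = 0 <-> exists y, x = b *: y.
Proof. by rewrite quotient_proj_eq0; split=> /asboolP. Qed.

Lemma reduction_kill M (y : reduction M) : b *: y = 0.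
Proof.
by have [x <-] := reduce_surj y; rewrite -linearZ; apply/reduce_eq0; exists x.
Qed.

Lemma reduction_iso M N : lmod_iso M N -> lmod_iso (reduction M) (reduction N).
Proof.
move=> /lmod_isoP[f [g [fK gK]]].
have [|||h _ hb] := @surj_ker_iso _ _ _ _ (reduce M) (reduce N \o f : {linear _ -> _}); last by exists h.
- exact: reduce_surj.
- by move=> y; have [x <-] := reduce_surj y; exists (g x); rewrite /= gK.
- move=> x; rewrite /= !reduce_eq0; split=> [[y ->]|[y e]].
    by exists (f y); rewrite linearZ.
  by exists (g y); rewrite -linearZ -e fK.
Qed.

Lemma sur_reduction M N : (forall x : N, b *: x = 0) ->
  card_Sur M N = card_Sur (reduction M) N.
Proof.
move=> kN.
have ex (f : {linear M -> N}) : exists h : {linear reduction M -> N}, forall x, h (reduce M x) = f x.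
  apply: linear_factor; first exact: reduce_surj.
  by move=> x /reduce_eq0[y ->]; rewrite linearZ /= kN.
have [h hE] := choice ex.
apply: (@ncard_bij _ _ h (fun g => g \o reduce M : {linear M -> N})).
- by move=> f fS y; have [x <-] := fS y; exists (reduce M x).
- by move=> g gS y; have [z <-] := gS y; have [x <-] := reduce_surj z; exists x.
- by move=> f _; apply: linear_eq => x; rewrite /= hE.
- by move=> g _; apply: linear_eq => y; have [x <-] := reduce_surj y; rewrite hE.
Qed.

Lemma fin_gen_cover M : fin_gen M -> (forall x : M, b *: x = 0) ->
  exists n (f : {linear {ffun 'I_n -> cyclic_module b} -> M}), forall y, exists x, f x = y.
Proof.
move=> [n [g gE]] kM; exists n.
have ex i : exists f : {linear cyclic_module b -> M}, f (cyc1 b) = g i by exact: cyc_map.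
have [f fE] := choice ex.
have fl : linear (fun v : {ffun 'I_n -> cyclic_module b} => \sum_i f i (v i)).
  move=> c u v; rewrite scaler_sumr -big_split /=; apply: eq_bigr => i _.
  by rewrite !ffunE linearP.
exists (mk_linear fl) => y; have [c ->] := gE y.
exists [ffun i => c i *: cyc1 b]; rewrite mk_linearE; apply: eq_bigr => i _.
by rewrite ffunE linearZ /= fE.
Qed.

Lemma finite_ffun_cyclic n : finite_set [set: cyclic_module b] ->
  finite_set [set: {ffun 'I_n -> cyclic_module b}].
Proof.
move=> fb; apply: (finite_inj (f := fun v : {ffun 'I_n -> cyclic_module b} => v : 'I_n -> _)).
  by apply: finite_fun => //; exact: finite_finset.
by move=> u v uv; apply/ffunP => i; rewrite uv.
Qed.

Lemma finite_reduction M : finite_set [set: cyclic_module b] -> fin_gen M ->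
  finite_set [set: reduction M].
Proof.
move=> fb [n [g gE]]; have [||m [f fS]] := @fin_gen_cover (reduction M).
- exists n, (fun i => reduce M (g i)) => y; have [x <-] := reduce_surj y.
  have [c ->] := gE x; exists c; rewrite linear_sum; apply: eq_bigr => i _.
  by rewrite linearZ.
- exact: reduction_kill.
exact: finite_surj (finite_ffun_cyclic m fb) fS.
Qed.

(** The universal bilinear map to M/bM is (x, y) -> c x for any lift c of y; another lift differs by
    a multiple of b, which kills M/bM. *)
Lemma tensor_reduction M G : is_tensor M (cyclic_module b) G <-> lmod_iso (reduction M) G.
Proof.
have ex (y : cyclic_module b) : exists c, c *: cyc1 b = y by have [c ->] := cyc_ex y; exists c.
have [s sE] := choice ex.
have sZ (c : R) y N (z : N) : b *: z = 0 -> c *: cyc1 b = y -> s y *: z = c *: z.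
  move=> bz cy; apply/eqP; rewrite -subr_eq0 -scalerBl.
  have /cyc_eq0[d ->] : (s y - c) *: cyc1 b = 0 by rewrite scalerBl sE cy subrr.
  by rewrite -scalerA bz scaler0.
pose t0 (x : M) (y : cyclic_module b) : reduction M := s y *: reduce M x.
have t1 x : t0 x (cyc1 b) = reduce M x.
  by rewrite /t0 (sZ 1) ?scale1r // reduction_kill.
have t0b : bilinear_map t0.
  split=> [x c y z|y c x x']; rewrite /t0.
    rewrite (sZ (c * s y + s z)) ?reduction_kill ?scalerDl -?scalerA ?sE //.
  by rewrite linearP scalerDr !scalerA mulrC.
have univ (V : lmodType R) (u : M -> cyclic_module b -> V) : bilinear_map u ->
    exists h : {linear reduction M -> V}, forall x y, h (t0 x y) = u x y.
  move=> [u1 u2].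
  have [||h hE] := @linear_factor _ _ _ _ (reduce M) (mk_linear (u2 (cyc1 b))).
  - exact: reduce_surj.
  - move=> x /reduce_eq0[y ->]; rewrite linearZ mk_linearE.
    rewrite -[u y]/(mk_linear (u1 y) : _ -> _) -linearZ /=.
    by rewrite cyc_kill -[u y]/(mk_linear (u1 y) : _ -> _) linear0.
  exists h => x y; rewrite linearZ /= hE mk_linearE -[in RHS](sE y).
  by rewrite -[u x]/(mk_linear (u1 x) : _ -> _) linearZ.
split=> [[t [tb tU]]|].
  have [t1l t2l] := tb.
  have [f [fE _]] := tU _ t0 t0b; have [g gE] := univ _ t tb.
  exists g; exists f => [y|z].
    by have [x <-] := reduce_surj y; rewrite -t1 gE fE.
  (* The uniqueness clause for [t] itself forces g f to be the identity of G. *)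
  have [e [_ eU]] := tU _ t tb.
  have e1 : e = (g \o f : {linear G -> G}) by apply: eU => x y; rewrite /= fE gE.
  have e2 : e = (idfun : {linear G -> G}) by apply: eU.
  have := etrans (esym e1) e2.
  by move=> /(congr1 (fun h : {linear G -> G} => h z)).
move=> /lmod_isoP[f [g [fK gK]]].
exists (fun x y => f (t0 x y)); split.
  by case: t0b => h1 h2; split=> [x c y z|y c x x']; rewrite ?h1 ?h2 linearP.
move=> V u ub; have [h hE] := univ V u ub.
exists (h \o g : {linear G -> V}); split=> [x y|k kE]; first by rewrite /= fK hE.
apply: linear_eq => z; rewrite /= -[z in RHS]gK; have [x xE] := reduce_surj (g z).
by rewrite -xE -t1 kE hE.
Qed.

End Reduction.

(** * Representatives of the extensions *)

Section Representatives.
Variables (R : idomainType) (pi : R).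
Hypothesis pi_unif : uniformizer pi.
Hypothesis kfin : finite_set [set: cyclic_module pi].
Hypothesis pi_neq0 : pi != 0.
Implicit Types (M N G X Y F : lmodType R) (k : nat).
Local Notation q := (rcard pi).

Lemma finite_fin_gen N : finite_set [set: N] -> exists g : 'I_(ncard [set: N]) -> N,
  forall x, exists i, g i = x.
Proof.
move=> fN; pose s := fset_set [set: N].
exists (fun i => nth 0 s i) => x.
have xs : x \in s by rewrite in_fset_set // inE.
have lt : (index x s < ncard [set: N])%N by rewrite index_mem.
by exists (Ordinal lt); rewrite /= nth_index.
Qed.

(** Generated by its own elements, such a module is a quotient of X = (R/pi^a)^B, hence determined
    by a kernel. The index [L] records the kernel as a set of positions in an enumeration of the
    finite X. *)
Lemma small_modules a B : exists (I : finType) (M : I -> lmodType R),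
  forall N, finite_killed pi a N -> (ncard [set: N] <= B)%N -> exists i, lmod_iso N (M i).
Proof.
pose X := {ffun 'I_B -> cyclic_module (pi ^+ a)} : lmodType R.
have fX : finite_set [set: X] by apply: finite_ffun_cyclic; exact: finite_cyc_pow.
have [e eS] := finite_fin_gen fX.
pose P (L : {set 'I_(ncard [set: X])}) N := exists f : {linear X -> N},
  (forall y, exists x, f x = y) /\ forall i, f (e i) = 0 <-> i \in L.
have ex L : exists M, (exists N, P L N) -> P L M.
  by case: (pselect (exists N, P L N)) => [[N h]|n]; [exists N|exists (cyclic_module 1)].
have [M ME] := choice ex.
exists {set 'I_(ncard [set: X])}, M => N [fN kN] NB.
have [g gS] := finite_fin_gen fN.
have [f fS] : exists f : {linear X -> N}, forall y, exists x, f x = y.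
  (* The elements of N are its generators; the surplus among the B generators goes to 0. *)
  pose g' (i : 'I_B) := if insub (i : nat) is Some j then g j else 0.
  have ex1 i : exists f : {linear cyclic_module (pi ^+ a) -> N}, f (cyc1 _) = g' i by exact: cyc_map.
  have [f fE] := choice ex1.
  have fl : linear (fun v : X => \sum_i f i (v i)).
    move=> c u v; rewrite scaler_sumr -big_split /=; apply: eq_bigr => i _.
    by rewrite !ffunE linearP.
  exists (mk_linear fl) => y; have [j <-] := gS y.
  pose j' := widen_ord NB j.
  exists [ffun i => if i == j' then cyc1 _ else 0]; rewrite mk_linearE (bigD1 j') //=.
  rewrite ffunE eqxx fE big1 => [|i /negPf ij]; last by rewrite ffunE ij linear0.
  by rewrite addr0 /g' insubT //= => lt; congr g; exact: val_inj.
pose L := [set i | `[< f (e i) = 0 >]]%SET.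
have [|f' [f'S f'E]] := ME L.
  by exists N, f; split=> // i; rewrite inE; split=> /asboolP.
exists L; have [|h _ hb] := @surj_ker_iso _ _ _ _ f f' fS f'S; last by exists h.
move=> x; have [i <-] := eS x; rewrite f'E inE; by split=> /asboolP.
Qed.

Lemma kpow_ext_iso F k N N' (h : {linear N -> F}) : lmod_iso N N' -> kpow_ext pi k h ->
  exists h' : {linear N' -> F}, kpow_ext pi k h'.
Proof.
move=> /lmod_isoP[f [f' [fK f'K]]] [hS [g gb]].
exists (h \o f' : {linear N' -> F}); split=> [y|].
  by have [x <-] := hS y; exists (f x); rewrite /= fK.
have [w wE] : exists w : {linear kermod (h \o f' : {linear N' -> F}) -> kermod h}, forall x, val (w x) = f' (val x).
  exact: kernel_map.
have [w' w'E] : exists w' : {linear kermod h -> kermod (h \o f' : {linear N' -> F})}, forall x, val (w' x) = f (val x).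
  by apply: kernel_map => x hx /=; rewrite fK.
exists (g \o w : {linear _ -> _}); apply: bij_comp => //.
by exists w' => x; apply: val_inj; rewrite ?wE ?w'E ?wE ?fK ?f'K.
Qed.

(** The index set does not depend on [k]: up to isomorphism an extension of [F]
    by [kappa^k] is [N' + kappa^m] with [#|N'| <= #|F|^2]. *)
Lemma kpow_ext_reps F a : finite_killed pi a F ->
  exists (I : finType) (M : nat -> I -> lmodType R) (P : nat -> pred I), forall k,
  [/\ forall i, P k i -> finite_killed pi a (M k i) /\
        exists h : {linear M k i -> F}, kpow_ext pi k h,
      forall i j, P k i -> P k j -> lmod_iso (M k i) (M k j) -> i = j &
      forall N (h : {linear N -> F}), finite_killed pi a N -> kpow_ext pi k h ->
        exists2 i, P k i & lmod_iso N (M k i)].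
Proof.
move=> [fF kF]; set c := ncard [set: F].
have q1 := rcard_gt1 pi_unif kfin.
have [I [M0 M0E]] := small_modules a (c * c).
(* The number of copies of kappa is forced by the order #F q^k of an extension; 0 is a dummy when
   none fits. *)
have exm k i : exists m, (exists m', (ncard [set: M0 i] * q ^ m' = c * q ^ k)%N) ->
    (ncard [set: M0 i] * q ^ m = c * q ^ k)%N.
  by case: (pselect (exists m', (ncard [set: M0 i] * q ^ m' = c * q ^ k)%N)) => [[m h]|n]; [exists m|exists 0%N].
have [m mE] := choice (fun ki => exm ki.1 ki.2).
pose M k i := addk pi (M0 i) (m (k, i)).
pose P0 k i := finite_killed pi a (M k i) /\ exists h : {linear M k i -> F}, kpow_ext pi k h.
(* Keep the extension of least rank in each isomorphism class, so that no class is counted twice. *)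
pose P k i := `[< P0 k i /\ forall j, P0 k j -> lmod_iso (M k j) (M k i) -> (enum_rank i <= enum_rank j)%N >].
exists I, M, P => k; split.
- by move=> i /asboolP[[? ?] _].
- move=> i j /asboolP[Pi ui] /asboolP[Pj uj] ij; apply: enum_rank_inj; apply: val_inj.
  by apply/eqP; rewrite eqn_leq (uj i) // (ui j) //; exact: lmod_iso_sym.
move=> N h kN hS; have fN := proj1 kN.
have [i iso] : exists i, lmod_iso N (M k i).
  have [l [N' [isoN kN' s]]] := split_socle pi_unif kfin kN; have fN' := proj1 kN'.
  have radc : (rad_card pi N' <= c)%N.
    by rewrite -(rad_addk pi_unif kfin l fN') -(iso_rad pi isoN); exact: kpow_ext_rad fN hS.
  have [|i isoi] := M0E N' kN'.
    by rewrite (soc_rad pi) // leq_mul // (leq_trans s).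
  exists i; apply: (lmod_iso_trans isoN).
  have cE : (ncard [set: M0 i] * q ^ l = c * q ^ k)%N.
    by rewrite -(iso_ncard isoi) -(ncard_addk kfin) // -(iso_ncard isoN); exact: kpow_ext_ncard hS.
  have -> : M k i = addk pi (M0 i) l.
    congr (addk _ _ _); have := mE (k, i) (ex_intro _ l cE); rewrite /= -cE => /eqP.
    rewrite eqn_pmul2l ?eqn_exp2l // => [/eqP//|].
    by rewrite -(iso_ncard isoi); exact: (@ncard_gt0 _ _ 0).
  exact: addk_iso.
pose T j := `[< lmod_iso N (M k j) >].
have Ti : T i by exact/asboolP.
have [j /asboolP isoj jmin] := arg_minnP (fun j => enum_rank j : nat) Ti.
exists j => //; apply/asboolP; split.
  by split; [exact: iso_killed isoj kN|exact: kpow_ext_iso isoj hS].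
by move=> j' _ iso'; apply: jmin; apply/asboolP; apply: lmod_iso_trans isoj _; exact: lmod_iso_sym.
Qed.

End Representatives.

(** * Finiteness of the residue field *)

Section PadicIntegers.
Variables (p : nat) (p_pr : prime p).
Local Notation Zp := (padic_int p_pr).

Lemma padic_projM (x y : Zp) n : padic_proj (x * y) n = padic_proj x n * padic_proj y n.
Proof. by []. Qed.

Lemma padic_projB (x y : Zp) n : padic_proj (x - y) n = padic_proj x n - padic_proj y n.
Proof. by []. Qed.

Lemma padic_proj_nat m n : padic_proj (m%:R : Zp) n = m%:R.
Proof. by elim: m => [|m IH] //; rewrite mulrSr [RHS]mulrSr -IH. Qed.

Lemma padic_proj_natE m n : padic_proj (m%:R : Zp) n = (m %% p ^ n.+1)%N :> nat.
Proof. by rewrite padic_proj_nat val_Zp_nat // padic_pX_gt1. Qed.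

Lemma padic_proj_pM (d : Zp) n :
  padic_proj (p%:R * d) n = (p * padic_proj d n %% p ^ n.+1)%N :> nat.
Proof. by rewrite padic_projM padic_valM // padic_proj_natE modnMml. Qed.

(** Division by p costs one digit of precision: the component of d at level n comes from that of z
    at level n + 1. *)
Lemma padic_p_dvd (z : Zp) : padic_proj z 0 = 0 -> exists d, z = p%:R * d.
Proof.
move=> z0; have p0 := prime_gt0 p_pr.
have dz n : (p %| padic_proj z n)%N.
  by have := padic_proj_mod z 0 n; rewrite add0n z0 expn1 => /eqP.
have lt n : (padic_proj z n.+1 %/ p < (Zp_trunc (p ^ n.+1)).+2)%N.
  by rewrite [X in (_ < X)%N]padic_Zp_cast // ltn_divLR // -expnSr padic_val_lt.
pose d n : 'Z_(p ^ n.+1) := Ordinal (lt n).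
have dP n : (d n.+1 %% p ^ n.+1)%N = d n.
  apply/eqP; rewrite -(eqn_pmul2l p0) muln_modr /= -expnS -(divnK (dz n.+2)) mulnK //.
  by rewrite mulnC divnK // [X in _ == X]mulnC divnK // padic_projP.
exists (PadicInt p_pr dP); apply: padic_int_eq => n; apply: val_inj.
apply: etrans (esym (padic_proj_pM _ n)).
by rewrite /= mulnC divnK // padic_projP.
Qed.

Lemma padic_decomp (c : Zp) : exists d, c = (padic_proj c 0 : nat)%:R + p%:R * d.
Proof.
have [|d dE] := @padic_p_dvd (c - (padic_proj c 0 : nat)%:R).
  by rewrite padic_projB padic_proj_nat natr_Zp subrr.
by exists d; rewrite -dE addrC subrK.
Qed.

Lemma padic_proj_lt (c : Zp) : (padic_proj c 0 < p)%N.
Proof. by have := padic_val_lt p_pr (padic_proj c 0); rewrite [X in (_ < X)%N -> _]expn1. Qed.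

Lemma padic_p_neq0 : (p%:R : Zp) != 0.
Proof.
apply/eqP => /(congr1 (fun z => padic_proj z 1 : nat)).
rewrite padic_proj_natE /= modn_small; last by rewrite -[X in (X < _)%N]expn1 ltn_exp2l ?prime_gt1.
by move=> p0; have := prime_gt0 p_pr; rewrite p0.
Qed.

Lemma padic_p_nonunit (c : Zp) : p%:R * c <> 1.
Proof.
have e1 : padic_proj (1 : Zp) 0 = 1%N :> nat.
  by rewrite (padic_proj_natE 1 0) [X in (_ %% X)%N]expn1 modn_small // prime_gt1.
move=> /(congr1 (fun z => padic_proj z 0 : nat)).
by rewrite padic_proj_pM e1 [X in (_ %% X)%N = _]expn1 modnMr.
Qed.

Lemma fraction_common_denom (A : idomainType) n (a : 'I_n -> {fraction A}) :
  exists (d : A) (c : 'I_n -> A), d != 0 /\ forall i, tofrac d * a i = tofrac (c i).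
Proof.
have ex (x : {fraction A}) : exists nd : A * A, nd.2 != 0 /\ tofrac nd.2 * x = tofrac nd.1.
  elim/quotW: x => x; exists (frac x); split; first exact: denom_ratioP.
  rewrite /tofrac; unlock FracField.tofrac; rewrite -[LHS]FracField.pi_mul.
  apply/eqmodP; rewrite /= FracField.equivfE /FracField.mulf.
  by rewrite !numden_Ratio ?(oner_eq0, mulf_neq0, denom_ratioP) // !mul1r mulr1.
have [nd ndE] := choice (fun i => ex (a i)).
exists (\prod_i (nd i).2), (fun i => (nd i).1 * \prod_(j | j != i) (nd j).2); split.
  by rewrite prodf_seq_neq0; apply/allP => i _; have [] := ndE i.
move=> i; have [_ e] := ndE i.
by rewrite (bigD1 i) //= !rmorphM /= mulrAC e.
Qed.

End PadicIntegers.

Section Torsion.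
Variables (p : nat) (p_pr : prime p) (V : zmodType).
Hypothesis pV : forall z : V, z *+ p = 0.

Lemma mulrn_mod (z : V) n : z *+ n = z *+ (n %% p).
Proof. by rewrite {1}(divn_eq n p) mulrnDr mulnC mulrnA pV mul0rn add0r. Qed.

Lemma mulrn_inv n (z : V) : (0 < n < p)%N -> exists l, z *+ n *+ l = z.
Proof.
move=> /andP[n0 np]; have cn : coprime n p.
  by rewrite coprime_sym prime_coprime // gtnNdvd.
have [l h] : exists l, (n * l = 1 %[mod p])%N.
  have [l m e _] := egcdnP p n0; exists l.
  by rewrite mulnC e (eqP cn) modnMDl.
by exists l; rewrite -mulrnA mulrn_mod h -mulrn_mod.
Qed.

(** As x 0 is nonzero and x 1 is not a multiple of it, c 2 cannot vanish and is invertible modulo p.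
    Opposites are multiples by p - 1, so all coefficients stay natural numbers. *)
Lemma torsion_span (x : 'I_3 -> V) (c : 'I_3 -> nat) : \sum_i x i *+ c i = 0 ->
  (forall i, (c i < p)%N) -> (exists i, (0 < c i)%N) ->
  x 0 <> 0 -> (forall n, x 1 <> x 0 *+ n) ->
  exists m n, x 2 = x 0 *+ m + x 1 *+ n.
Proof.
move=> cx cp [i ci] x0 x1.
have neg (u v : V) : u + v = 0 -> v = u *+ p.-1.
  move=> uv; apply: (addrI u); rewrite uv -{1}[u]mulr1n -mulrnDr add1n prednK ?pV //.
  exact: prime_gt0.
have inv j : (0 < c j)%N -> exists l, x j *+ c j *+ l = x j.
  by move=> cj; apply: mulrn_inv; rewrite cj cp.
have {}cx : x 0 *+ c 0 + x 1 *+ c 1 + x 2 *+ c 2 = 0.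
  apply: etrans cx; rewrite !big_ord_recr big_ord0 /= add0r.
  by congr (x _ *+ c _ + x _ *+ c _ + x _ *+ c _); exact: val_inj.
have [c2|/inv[l lE]] := posnP (c 2); last first.
  exists (c 0%R * p.-1 * l)%N, (c 1%R * p.-1 * l)%N.
  by rewrite -lE (neg _ _ cx) !mulrnDl -!mulrnA !mulnA.
move: cx; rewrite c2 mulr0n addr0 => cx.
have [c1|/inv[l lE]] := posnP (c 1); last first.
  by move: lE; rewrite (neg _ _ cx) -!mulrnA => /esym/x1.
move: cx; rewrite c1 mulr0n addr0 => cx.
have /inv[l lE] : (0 < c 0%R)%N.
  have [e|[e|e]] : i = 0 \/ i = 1 \/ i = 2.
    by case: i {ci} => -[|[|[|//]]] ?; [left|right; left|right; right]; exact: val_inj.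
  - by rewrite -e.
  - by rewrite e c1 in ci.
  - by rewrite e c2 in ci.
by case: x0; rewrite -lE cx mul0rn.
Qed.

End Torsion.

Section ResidueField.
Variables (p : nat) (p_pr : prime p) (K : fieldExtType (padic p_pr)).
Local Notation Zp := (padic_int p_pr).
Local Notation O := (ring_of_integers K).
Local Notation iota := (@padic_int_embed p p_pr K).

Lemma iota_inj : injective iota.
Proof. by move=> x y /fmorph_inj /eqP; rewrite tofrac_eq => /eqP. Qed.

Lemma iota_integral (c : Zp) : iota c \in @padic_integral p p_pr K.
Proof. exact/asboolP/integral_id. Qed.

Definition padic_to_roi (c : Zp) : O := RingOfIntegers (iota_integral c).

Lemma iota_nat n : iota n%:R = n%:R.
Proof. exact: (rmorph_nat iota). Qed.

Lemma iota0 : iota 0 = 0. Proof. exact: (rmorph0 iota). Qed.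
Lemma iota1 : iota 1 = 1. Proof. exact: (rmorph1 iota). Qed.
Lemma iotaM x y : iota (x * y) = iota x * iota y. Proof. exact: (rmorphM iota). Qed.
Lemma iotaD x y : iota (x + y) = iota x + iota y. Proof. exact: (rmorphD iota). Qed.

Lemma iota_sum n (f : 'I_n -> Zp) : iota (\sum_i f i) = \sum_i iota (f i).
Proof. exact: (rmorph_sum iota). Qed.

Lemma iotaX x n : iota (x ^+ n) = iota x ^+ n.
Proof. exact: (rmorphXn iota). Qed.

Lemma roi_nat n : val (n%:R : O) = n%:R.
Proof. exact: (rmorph_nat (val : {rmorphism O -> K})). Qed.

Lemma p_neq0 : (p%:R : O) != 0.
Proof.
apply/eqP => /(congr1 val); rewrite roi_nat -iota_nat -[val 0]iota0.
by move=> /iota_inj/eqP; apply/negP; exact: padic_p_neq0.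
Qed.

(** If y is integral of degree n over Z_p and p y = 1, multiplying its monic equation by p^n gives 1
    + p c = 0 in Z_p, which is impossible modulo p. *)
Lemma p_nonunit : (p%:R : O) \isn't a GRing.unit.
Proof.
apply/negP => /unitrPr[y py]; have /asboolP[P Pm Py] := roi_valP y.
have {}py : iota p%:R * val y = 1 by rewrite iota_nat -roi_nat -[LHS]/(val (p%:R * y)) py.
have [n sP] : exists n, size P = n.+1.
  by exists (size P).-1; rewrite prednK // size_poly_gt0 monic_neq0.
have lP : P`_n = 1 by have /monicP := Pm; rewrite lead_coefE sP.
have cP i : (map_poly iota P)`_i = iota P`_i by rewrite coef_map.
move: Py => /rootP; rewrite horner_coef size_map_poly_id0; last first.
  by rewrite (monicP Pm) iota1 oner_neq0.
rewrite sP big_ord_recr /= cP lP iota1 mul1r => /(congr1 (fun z => iota p%:R ^+ n * z)).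
rewrite mulr0 mulrDr -exprMn py expr1n mulr_sumr.
have -> : \sum_(i < n) iota p%:R ^+ n * ((map_poly iota P)`_i * val y ^+ i) =
    iota (p%:R * \sum_(i < n) P`_i * p%:R ^+ (n - i).-1).
  rewrite iotaM iota_sum mulr_sumr; apply: eq_bigr => i _.
  rewrite cP iotaM iotaX mulrCA [RHS]mulrCA; congr (_ * _).
  rewrite -exprS prednK ?subn_gt0 //.
  have -> : iota p%:R ^+ n = iota p%:R ^+ (n - i) * iota p%:R ^+ i.
    by rewrite -exprD subnK // ltnW.
  by rewrite -mulrA -exprMn py expr1n mulr1.
rewrite -[X in _ + X]iota1 -iotaD -[X in _ = X]iota0 => /iota_inj/eqP.
rewrite addr_eq0 => /eqP e; apply: (@padic_p_nonunit p p_pr (- \sum_(i < n) P`_i * p%:R ^+ (n - i).-1)).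
by rewrite mulrN e opprK.
Qed.

(** Three vectors in dimension 2 are dependent over Q_p; the denominators are then cleared. *)
Lemma padic_relation (x : 'I_3 -> K) : \dim {:K} = 2%N ->
  exists c : 'I_3 -> Zp, \sum_i iota (c i) * x i = 0 /\ exists i, c i != 0.
Proof.
move=> dK.
have nf : ~~ free [tuple x i | i < 3].
  apply/negP => /eqP e.
  have := dimvS (subvf <<[tuple x i | i < 3]>>%VS); rewrite dK.
  by rewrite e size_tuple.
have [k [ks [i0 ki0]]] : exists k : 'I_3 -> padic p_pr, \sum_i k i *: x i = 0 /\ exists i, k i != 0.
  apply: contrapT => h; move/negP: nf; apply; apply/freeP => k ks i.
  apply: contrapT => ki; apply: h; exists k; split; last by exists i; apply/eqP.
  by rewrite -[RHS]ks; apply: eq_bigr => j _; rewrite (nth_map j) ?size_enum_ord // nth_ord_enum.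
have [d [c [d0 dc]]] := fraction_common_denom k.
have iE (z : Zp) (u : K) : iota z * u = tofrac z *: u.
  by rewrite /padic_int_embed /= mulr_algl.
exists c; split.
  under eq_bigr do rewrite iE -dc -scalerA.
  by rewrite -scaler_sumr ks scaler0.
exists i0; rewrite -tofrac_eq0 -dc mulf_neq0 // tofrac_eq0 //.
Qed.

(** Some coefficient is nonzero modulo some power of p; while all coefficients are divisible by p,
    dividing by p lowers that power. *)
Lemma padic_primitive_relation (x : 'I_3 -> K) : \dim {:K} = 2%N ->
  exists c : 'I_3 -> Zp, \sum_i iota (c i) * x i = 0 /\ exists i, padic_proj (c i) 0 != 0.
Proof.
move=> /padic_relation-/(_ x)[c [cx [i ci]]].
have [n cn] : exists n, padic_proj (c i) n != 0.
  apply: contrapT => h; move/eqP: ci; apply; apply: padic_int_eq => n.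
  by apply: contrapT => cn; apply: h; exists n; apply/eqP.
elim: n c cx {ci} cn => [|n IH] c cx cn; first by exists c; split=> //; exists i.
case: (pselect (exists j, padic_proj (c j) 0 != 0)) => [h|h]; first by exists c.
have ex j : exists d, c j = p%:R * d.
  by apply: padic_p_dvd; apply: contrapT => cj; apply: h; exists j; apply/eqP.
have [d dE] := choice ex; apply: (IH d).
  have : iota p%:R * \sum_j iota (d j) * x j = 0.
    by rewrite mulr_sumr -[RHS]cx; apply: eq_bigr => j _; rewrite dE iotaM mulrA.
  move=> /eqP; rewrite mulf_eq0 => /orP[|/eqP//].
  rewrite -iota0 (inj_eq iota_inj) => /eqP p0.
  by have := padic_p_neq0 p_pr; rewrite p0 eqxx.
apply: contra cn => /eqP dn; apply/eqP; apply: val_inj; rewrite dE.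
apply: etrans (padic_proj_pM _ _) _.
have := padic_projP (d i) n; rewrite dn => /= /eqP; rewrite -/(dvdn _ _) => h1.
by apply/eqP; rewrite -/(dvdn _ _) [X in (X %| _)%N]expnS dvdn_pmul2l // prime_gt0.
Qed.

Section Finite.
Hypothesis K_quadratic : \dim {:K} = 2%N.
Variable pi : O.
Hypothesis pi_unif : uniformizer pi.
Local Notation kappa := (cyclic_module pi).
Local Notation one := (cyc1 pi).

Lemma p_dvd_pi : exists e, (p%:R : O) = e * pi.
Proof. by have [u|//] := unit_or pi_unif p%:R; have := p_nonunit; rewrite u. Qed.

Lemma uniformizer_neq0 : pi != 0.
Proof.
have [e pe] := p_dvd_pi; apply/eqP => pi0.
by have := p_neq0; rewrite pe pi0 mulr0 eqxx.
Qed.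

Lemma kappa_p (z : kappa) : z *+ p = 0.
Proof.
have [e pe] := p_dvd_pi.
by rewrite -scaler_nat pe -scalerA cyc_kill scaler0.
Qed.

(** Since p lies in pi O, only the first digits of a relation over Z_p act on kappa, and primitivity
    keeps one of them nonzero. *)
Lemma kappa_relation (x : 'I_3 -> O) : exists c : 'I_3 -> nat,
  [/\ \sum_i (x i *: one) *+ c i = 0, forall i, (c i < p)%N & exists i, (0 < c i)%N].
Proof.
have [c [cx [i ci]]] := padic_primitive_relation (fun i => val (x i)) K_quadratic.
exists (fun i => padic_proj (c i) 0 : nat); split; last 2 first.
- by move=> j; exact: padic_proj_lt.
- by exists i; rewrite lt0n.
have [d dE] := choice (fun j => padic_decomp (c j)).
have e : \sum_j (padic_proj (c j) 0 : nat)%:R * x j = - (p%:R * \sum_j padic_to_roi (d j) * x j).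
  apply/eqP; rewrite -subr_eq0 opprK mulr_sumr -big_split /=; apply/eqP.
  apply: val_inj; apply: etrans (rmorph_sum (val : {rmorphism O -> K}) _ _ _) _.
  rewrite -[RHS]cx; apply: eq_bigr => j _.
  rewrite mulrA -mulrDl -[LHS]/(val _ * val _); congr (_ * _).
  by rewrite [in RHS]dE iotaD iotaM !iota_nat -!roi_nat.
under eq_bigr do rewrite -scaler_nat scalerA.
rewrite -scaler_suml e; apply/cyc_eq0; have [u uE] := p_dvd_pi.
by exists (- u * \sum_j padic_to_roi (d j) * x j); rewrite uE; ring.
Qed.

(** The residue field has dimension at most 2 over the prime field: either 1 spans it, or 1 and any
    x1 outside that span do, by the relation among 1, x1 and x. *)
Lemma finite_kappa : finite_set [set: kappa].
Proof.
pose comb (x : O) (ij : 'I_p * 'I_p) : kappa := one *+ ij.1 + (x *: one) *+ ij.2.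
have lt n : (n %% p < p)%N by rewrite ltn_mod prime_gt0.
suff [x xS] : exists x, forall y, exists ij, comb x ij = y.
  exact: (@finite_surj _ _ (comb x) (@finite_finset _ setT) xS).
have combE x i j : comb x (Ordinal (lt i), Ordinal (lt j)) = one *+ i + (x *: one) *+ j.
  by rewrite /comb /= -!(mulrn_mod kappa_p).
case: (pselect (exists x : O, forall i, x *: one <> one *+ i)) => [[x1 nx1]|h]; last first.
  exists 0 => y; have [c ->] := cyc_ex y.
  have [i ci] : exists i, c *: one = one *+ i.
    by apply: contrapT => hc; apply: h; exists c => i ci; apply: hc; exists i.
  by exists (Ordinal (lt i), Ordinal (lt 0)); rewrite combE ci addr0.
exists x1 => y; have [x ->] := cyc_ex y.
have [c [cx cp [i ci]]] := kappa_relation (fun i => nth 0 [:: 1; x1; x] i).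
have [||m [n e]] := torsion_span p_pr kappa_p cx cp (ex_intro _ i ci).
- by rewrite /= scale1r; exact: one_neq0.
- by move=> n; rewrite /= scale1r; exact: nx1.
by exists (Ordinal (lt m), Ordinal (lt n)); rewrite combE; move: e; rewrite /= scale1r.
Qed.

End Finite.
End ResidueField.

(** * Limits of moments *)

Section IntegralBounds.
Variables (U : realType) (d : measure_display) (T : measurableType d) (P : probability T U).

Lemma Rintegral_sum (J : finType) (D : pred J) (f : J -> T -> U) (c : J -> U) :
  (forall j, D j -> P.-integrable [set: T] (EFin \o f j)) ->
  P.-integrable [set: T] (EFin \o (fun w => \sum_(j | D j) c j * f j w)) /\
  (\int[P]_w (\sum_(j | D j) c j * f j w) = \sum_(j | D j) c j * \int[P]_w f j w)%R.
Proof.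
move=> fi; rewrite -big_filter.
under [X in EFin \o X]funext do rewrite -big_filter.
under eq_Rintegral do rewrite -big_filter.
have : all D [seq j <- index_enum J | D j] by exact: filter_all.
elim: [seq j <- index_enum J | D j] => [_|j s IH /= /andP[/fi fj /IH[si sE]]].
  split; last by rewrite big_nil; under eq_Rintegral do rewrite big_nil; rewrite Rintegral_cst // mul0r.
  under [X in EFin \o X]funext do rewrite big_nil; exact: integrable0.
have cj : P.-integrable [set: T] (EFin \o (fun w => c j * f j w)).
  rewrite (_ : EFin \o _ = (fun w => (c j)%:E * (f j w)%:E)%E); first exact: integrableZl.
  by apply/funext => w /=; rewrite EFinM.
split.
  rewrite (_ : EFin \o _ = ((EFin \o (fun w => c j * f j w)%R) \+
      (EFin \o (fun w => \sum_(j <- s) c j * f j w)%R))%E).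
    exact: integrableD.
  by apply/funext => w /=; rewrite big_cons EFinD.
under eq_Rintegral do rewrite big_cons.
by rewrite RintegralD // sE big_cons RintegralZl.
Qed.

Lemma probability_moment_bound (E : set T) (S : U) (h g : T -> U) : measurable E ->
  P.-integrable [set: T] (EFin \o h) -> P.-integrable [set: T] (EFin \o g) ->
  (forall w, `| S * \1_E w - h w | <= g w) ->
  `| S * fine (P E) - \int[P]_w h w | <= \int[P]_w g w.
Proof.
move=> mE hi gi hg.
have Ei : P.-integrable [set: T] (EFin \o (fun w => S * \1_E w)).
  rewrite (_ : EFin \o _ = (fun w => S%:E * (\1_E w)%:E)%E).
    by apply: integrableZl => //; exact: integrable_indic.
  by apply/funext => w /=; rewrite EFinM.
have EE : \int[P]_w (S * \1_E w) = S * fine (P E).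
  rewrite RintegralZl //; last exact: integrable_indic.
  by rewrite /Rintegral integral_indic // setIT.
rewrite -EE -RintegralB //.
have Di : P.-integrable [set: T] (EFin \o (fun w => S * \1_E w - h w)).
  rewrite (_ : EFin \o _ = ((EFin \o (fun w => S * \1_E w)%R) \- (EFin \o h))%E); first exact: integrableB.
  by apply/funext => w /=; rewrite EFinB.
apply: (le_trans (le_normr_Rintegral _ Di)) => //.
apply: le_Rintegral => //; exact: integrable_norm Di.
Qed.

End IntegralBounds.

Section MomentLimit.
Variable U : realType.

Lemma cvg_lincomb (J : finType) (D : pred J) (f : nat -> J -> U) (c L : J -> U) :
  (forall j, D j -> f n j @[n --> \oo] --> L j) ->
  \sum_(j | D j) c j * f n j @[n --> \oo] --> \sum_(j | D j) c j * L j.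
Proof.
move=> fL; rewrite -big_filter; under eq_fun do rewrite -big_filter.
have : all D [seq j <- index_enum J | D j] by exact: filter_all.
elim: [seq j <- index_enum J | D j] => [_|j s IH /= /andP[/fL fj /IH h]].
  by rewrite big_nil; under eq_fun do rewrite big_nil; exact: cvg_cst.
rewrite big_cons.
have -> : (fun n => \sum_(i <- j :: s) c i * f n i) = (fun n => c j * f n j + \sum_(i <- s) c i * f n i).
  by apply/funext => n; rewrite big_cons.
by apply: cvgD => //; apply: cvgM => //; exact: cvg_cst.
Qed.

Lemma moment_sandwich (d : nat -> measure_display) (T : forall n, measurableType (d n))
    (P : forall n, probability (T n) U) (E : forall n, set (T n)) (I : finType)
    (D : nat -> pred I) (Z : forall n, nat -> I -> T n -> U) (al L : nat -> I -> U) (S : U) :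
  (forall n, measurable (E n)) ->
  (forall n k i, measurable_fun [set: T n] (Z n k i)) ->
  (forall n k i w, 0 <= Z n k i w) ->
  (forall k i, D k i -> expectation (P n) (Z n k i) @[n --> \oo] --> (L k i)%:E) ->
  (forall n w m, `| S * \1_(E n) w
      - \sum_(k < m) (-1) ^+ k * \sum_(i | D k i) al k i * Z n k i w |
    <= \sum_(i | D m i) al m i * Z n m i w) ->
  forall m e, 0 < e -> \forall n \near \oo,
    `| S * fine (P n (E n)) - \sum_(k < m) (-1) ^+ k * \sum_(i | D k i) al k i * L k i |
    <= \sum_(i | D m i) al m i * L m i + e.
Proof.
move=> mE mZ Z0 ZL ZE m e e0.
pose r n k i := fine (expectation (P n) (Z n k i)).
have rL k i : D k i -> r n k i @[n --> \oo] --> L k i by move=> /ZL /fine_cvg.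
have cs : \sum_(k < m) (-1) ^+ k * \sum_(i | D k i) al k i * r n k i @[n --> \oo] -->
    \sum_(k < m) (-1) ^+ k * \sum_(i | D k i) al k i * L k i.
  by apply: (@cvg_lincomb _ xpredT) => k _; apply: cvg_lincomb => i; exact: rL.
have ct : \sum_(i | D m i) al m i * r n m i @[n --> \oo] --> \sum_(i | D m i) al m i * L m i.
  by apply: cvg_lincomb => i; exact: rL.
have e2 : 0 < e / 2 by rewrite divr_gt0.
(* An expectation may be infinite for small n. Convergence to a real limit makes it finite
   eventually, and uniformly over the finitely many pairs (k, i) with k <= m. *)
have fin : \forall n \near \oo, forall ki : 'I_m.+1 * I, D ki.1 ki.2 ->
    expectation (P n) (Z n ki.1 ki.2) \is a fin_num.
  apply: filter_forall => -[k i] /=; case: (boolP (D k i)) => [Di|_]; last exact: nearW.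
  by have := cvg_is_fine (ZL k i Di); apply: filterS.
near=> n.
have fn k i : (k < m.+1)%N -> D k i -> expectation (P n) (Z n k i) \is a fin_num.
  move=> km Di; have h : forall ki : 'I_m.+1 * I, D ki.1 ki.2 ->
    expectation (P n) (Z n ki.1 ki.2) \is a fin_num by near: n.
  exact: (h (Ordinal km, i)).
have iZ k i : (k < m.+1)%N -> D k i -> (P n).-integrable [set: T n] (EFin \o Z n k i).
  move=> km Di; apply/integrableP; split; first exact/measurable_EFinP.
  under eq_integral do rewrite /= ger0_norm //.
  have := fn k i km Di; rewrite unlock fin_numElt => /andP[_].
  by [].
have rE k i : r n k i = \int[P n]_w Z n k i w by rewrite /r unlock.
have iD k : (k < m.+1)%N ->
    (P n).-integrable [set: T n] (EFin \o (fun w => \sum_(i | D k i) al k i * Z n k i w)) /\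
    \int[P n]_w (\sum_(i | D k i) al k i * Z n k i w) = \sum_(i | D k i) al k i * r n k i.
  move=> km; have [|h1 h2] := @Rintegral_sum _ _ _ (P n) _ (D k) (Z n k) (al k).
    by move=> i; exact: iZ.
  by split=> //; rewrite h2; apply: eq_bigr => i _; rewrite rE.
have [iS ES] : (P n).-integrable [set: T n] (EFin \o (fun w =>
      \sum_(k < m) (-1) ^+ k * \sum_(i | D k i) al k i * Z n k i w)) /\
    \int[P n]_w (\sum_(k < m) (-1) ^+ k * \sum_(i | D k i) al k i * Z n k i w) =
    \sum_(k < m) (-1) ^+ k * \sum_(i | D k i) al k i * r n k i.
  have [|h1 h2] := @Rintegral_sum _ _ _ (P n) _ xpredT
    (fun (k : 'I_m) w => \sum_(i | D k i) al k i * Z n k i w) (fun k => (-1) ^+ k).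
    by move=> k _; have [] := iD k (ltnW (ltn_ord k)).
  split=> //; rewrite h2; apply: eq_bigr => k _.
  by have [_ ->] := iD k (ltnW (ltn_ord k)).
have [iT ET] := iD m (ltnSn m).
have := probability_moment_bound (mE n) iS iT (fun w => ZE n w m).
rewrite ES ET => h.
have h1 : `| \sum_(k < m) (-1) ^+ k * \sum_(i | D k i) al k i * r n k i -
    \sum_(k < m) (-1) ^+ k * \sum_(i | D k i) al k i * L k i | <= e / 2.
  by near: n; exact: cvgr_distC_le cs _ e2.
have h2 : `| \sum_(i | D m i) al m i * r n m i - \sum_(i | D m i) al m i * L m i | <= e / 2.
  by near: n; exact: cvgr_distC_le ct _ e2.
move: h h1 h2; set x := S * _; set y := \sum_(k < m) _; set z := \sum_(k < m) _.
set u := \sum_(i | _) _; set v := \sum_(i | _) _.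
rewrite !ler_norml => /andP[a1 a2] /andP[b1 b2] /andP[c1 c2].
by apply/andP; split; lra.
Unshelve. all: by end_near.
Qed.

(** S u_n and S v_n are both eventually close to the same centre s m, so u_n - v_n becomes small
    once m is chosen with t m small. *)
Lemma sandwich_cvg (u v s t : nat -> U) (S l : U) : 0 < S -> u @ \oo --> l ->
  t @ \oo --> 0 ->
  (forall m (e : U), 0 < e -> \forall n \near \oo, `|S * u n - s m| <= t m + e) ->
  (forall m (e : U), 0 < e -> \forall n \near \oo, `|S * v n - s m| <= t m + e) ->
  v @ \oo --> l.
Proof.
move=> S0 ul t0 us vs; apply/cvgrPdist_le => e e0.
(* Two bounds, each made of [t m] and a slack, give four such terms: S e/2 in all. The other e/2 is
   for u - l. *)
have eS : 0 < e * S / 8 by rewrite divr_gt0 // mulr_gt0.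
have [m tm] : exists m, t m <= e * S / 8.
  have [N _ h] : \forall m \near \oo, t m <= e * S / 8 by exact: (cvgr_le _ t0).
  by exists N; exact: h (leqnn N).
near=> n.
have h1 : `|l - u n| <= e / 2 by near: n; apply: cvgr_dist_le ul _ _; rewrite divr_gt0.
have h2 : `|S * u n - s m| <= t m + e * S / 8 by near: n; exact: us.
have h3 : `|S * v n - s m| <= t m + e * S / 8 by near: n; exact: vs.
have h4 : S * `|u n - v n| <= S * (e / 2).
  rewrite -[X in X * _ <= _](gtr0_norm S0) -normrM mulrBr.
  rewrite !ler_norml in h2 h3 *; move: h2 h3 => /andP[? ?] /andP[? ?].
  by apply/andP; split; lra.
rewrite ler_pM2l // in h4.
apply: (le_trans (ler_distD (u n) _ _)); lra.
Unshelve. all: by end_near.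
Qed.

End MomentLimit.

(** * The sandwich for random modules *)

Section RandomModules.
Variables (R : idomainType) (pi : R) (U : realType).
Hypothesis pi_unif : uniformizer pi.
Hypothesis kfin : finite_set [set: cyclic_module pi].
Hypothesis pi_neq0 : pi != 0.
Implicit Types (M N F : lmodType R).
Local Notation Q := ((rcard pi)%:R : U).

Lemma tail_ratio_lt1 : Q `^ (- 2^-1) < 1.
Proof.
have Q1 : 1 < Q by rewrite ltr1n; exact: rcard_gt1.
have Q0 : 0 < Q by exact: lt_trans Q1.
rewrite ltNge; apply/negP => r1.
have := ler_pM ler01 ler01 r1 r1; rewrite mulr1 -powRD ?(gt_eqF Q0) ?implybT //.
have -> : - 2^-1 + - 2^-1 = - 1 :> U by field.
by rewrite (powR_inv1 (ltW Q0)) leNgt invf_lt1 // Q1.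
Qed.

(** The index type [I] is the same for all m, so a geometric bound on each summand bounds the
    sum. *)
Lemma tail_cvg0 F a (I : finType) (M : nat -> I -> lmodType R) (P : nat -> pred I)
    (L : nat -> I -> U) C : finite_set [set: F] ->
  (forall k i, P k i -> finite_killed pi a (M k i) /\
     exists h : {linear M k i -> F}, kpow_ext pi k h) ->
  (forall k i, P k i -> `|L k i| <= C * moment_weight pi (M k i) U) ->
  \sum_(i | P m i) ext_weight pi U F m (M m i) * L m i @[m --> \oo] --> 0.
Proof.
move=> fF MP LC.
pose K := `|C| * (16 * (card_Sur F F)%:R * Q `^ (2 * (ncard [set: F])%:R ^+ 2)).
have K0 : 0 <= K by rewrite !mulr_ge0 // powR_ge0.
apply: norm_cvg0.
apply: (squeeze_cvgr (f := fun=> 0) (h := geometric (#|I|%:R * K) (Q `^ (- 2^-1)))).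
- apply: nearW => m; rewrite normr_ge0 /= (le_trans (ler_norm_sum _ _ _)) //.
  have -> : #|I|%:R * K * Q `^ (- 2^-1) ^+ m = \sum_(i : I) K * Q `^ (- 2^-1) ^+ m.
    by rewrite sumr_const -[RHS]mulr_natl mulrA.
  rewrite [leRHS](bigID (P m)) /= -[leLHS]addr0; apply: lerD; last first.
    by apply: sumr_ge0 => i _; rewrite mulr_ge0 // exprn_ge0 // powR_ge0.
  apply: ler_sum => i Pi; have [kM [h hS]] := MP m i Pi.
  have w0 : 0 <= moment_weight pi (M m i) U by exact: powR_ge0.
  have a0 := ext_weight_ge0 pi U F m (M m i).
  rewrite normrM (ger0_norm a0).
  apply: (@le_trans _ _ (`|C| * (ext_weight pi U F m (M m i) * moment_weight pi (M m i) U))).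
    rewrite mulrCA; apply: ler_wpM2l => //; apply: (le_trans (LC m i Pi)).
    by apply: ler_wpM2r => //; exact: ler_norm.
  rewrite /K -[leRHS]mulrA; apply: ler_wpM2l => //.
  exact: (ext_weight_tail pi_unif kfin U pi_neq0 fF kM hS).
- exact: cvg_cst.
- by apply: cvg_geometric; rewrite ger0_norm ?powR_ge0 // tail_ratio_lt1.
Qed.

Lemma measurable_tensor_event d (T : measurableType d) (A : T -> lmodType R) b G :
  random_module A -> measurable [set w | is_tensor (A w) (cyclic_module b) G].
Proof.
move=> rA; apply: (random_measurable rA (C := fun M => is_tensor M (cyclic_module b) G)).
move=> M N MN; rewrite !tensor_reduction; apply: lmod_iso_trans.
exact/lmod_iso_sym/reduction_iso.
Qed.

Lemma measurable_card_Sur d (T : measurableType d) (A : T -> lmodType R) G :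
  random_module A -> measurable_fun [set: T] (fun w => (card_Sur (A w) G)%:R : U).
Proof.
move=> rA _ Y _; rewrite setTI.
apply: (random_measurable rA (C := fun M => Y (card_Sur M G)%:R)).
by move=> M N MN; rewrite (sur_iso_l G MN).
Qed.

(** The factor [card_Sur F F] is there because the inversion counts the isomorphisms from the
    reduction onto F, of which there are #Aut F or none. *)
Lemma tensor_probability_sandwich (d : nat -> measure_display)
    (T : forall n, measurableType (d n)) (P : forall n, probability (T n) U)
    (A : forall n, T n -> lmodType R) F a
    (I : finType) (M : nat -> I -> lmodType R) (D : nat -> pred I) (L : nat -> I -> U) :
  (forall n, random_module (A n)) -> finite_killed pi a F ->
  (forall k i, D k i -> finite_killed pi a (M k i)) ->
  (forall k i j, D k i -> D k j -> lmod_iso (M k i) (M k j) -> i = j) ->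
  (forall k N (h : {linear N -> F}), finite_killed pi a N -> kpow_ext pi k h ->
    exists2 i, D k i & lmod_iso N (M k i)) ->
  (forall k i, D k i ->
    expectation (P n) (fun w => (card_Sur (A n w) (M k i))%:R) @[n --> \oo] --> (L k i)%:E) ->
  forall m e, 0 < e -> \forall n \near \oo,
  `| (card_Sur F F)%:R * fine (P n [set w | is_tensor (A n w) (cyclic_module (pi ^+ a)) F])
     - \sum_(k < m) (-1) ^+ k * \sum_(i | D k i) ext_weight pi U F k (M k i) * L k i |
  <= \sum_(i | D m i) ext_weight pi U F m (M m i) * L m i + e.
Proof.
move=> rA kF kM uM cM ML.
apply: (moment_sandwich (Z := fun n k i w => (card_Sur (A n w) (M k i))%:R)) => //.
- by move=> n; exact: measurable_tensor_event.
- by move=> n k i; exact: measurable_card_Sur.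
move=> n w m; pose X := reduction (pi ^+ a) (A n w).
have kX : finite_killed pi a X.
  split; last exact: reduction_kill.
  by apply: finite_reduction; [exact: finite_cyc_pow|exact: random_fin_gen].
have cw k : \sum_(i | D k i) ext_weight pi U F k (M k i) * (card_Sur (A n w) (M k i))%:R =
    chain_weight pi U X F k.
  rewrite (@chain_weight_sum _ pi U X F k I (D k) (M k) a) //.
  - by apply: eq_bigr => i Di; rewrite (sur_reduction (A n w) (proj2 (kM k i Di))).
  - exact: (proj1 kF).
  - by move=> i /kM[].
  - exact: uM.
  - exact: cM.
rewrite cw; under eq_bigr do rewrite cw.
have -> : (card_Sur F F)%:R * \1_[set w | is_tensor (A n w) (cyclic_module (pi ^+ a)) F] w =
    (if `[< lmod_iso X F >] then card_Sur F F else 0)%N%:R :> U.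
  rewrite indicE; case: asboolP => [h|h].
    by rewrite mem_set ?mulr1 //=; apply/tensor_reduction.
  by rewrite memNset ?mulr0 //= => /tensor_reduction.
exact: (iso_indicator_bound pi_unif kfin U m kX (proj1 kF)).
Qed.

End RandomModules.

Unset Implicit Arguments.

Theorem theorem3p3 (R : realType) (p : nat) (p_pr : prime p)
    (K : fieldExtType (padic p_pr)) (K_quadratic : \dim {:K} = 2%N)
    (pi : ring_of_integers K) (pi_uniformizer : uniformizer pi)
    (dA dB : nat -> measure_display)
    (TA : forall n : nat, measurableType (dA n))
    (TB : forall n : nat, measurableType (dB n))
    (PA : forall n : nat, probability (TA n) R)
    (PB : forall n : nat, probability (TB n) R)
    (A : forall n : nat, TA n -> lmodType (ring_of_integers K))
    (B : forall n : nat, TB n -> lmodType (ring_of_integers K))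
    (A_random : forall n : nat, random_module (A n))
    (B_random : forall n : nat, random_module (B n))
    (a : nat)
    (A_limit : forall G : lmodType (ring_of_integers K), finite_killed pi a G ->
      exists l : R,
        PA n [set w | is_tensor (A n w) (cyclic_module (pi ^+ a)) G]
          @[n --> \oo] --> l%:E)
    (moments : exists C : R,
      forall G : lmodType (ring_of_integers K), finite_killed pi a G ->
      exists L : R,
        [/\ expectation (PA n) (fun w => (card_Sur (A n w) G)%:R)
              @[n --> \oo] --> L%:E,
            expectation (PB n) (fun w => (card_Sur (B n w) G)%:R)
              @[n --> \oo] --> L%:E
          & `|L| <= C * moment_weight pi G R]) :
  forall G : lmodType (ring_of_integers K), finite_killed pi a G ->
  exists l : R,
    PA n [set w | is_tensor (A n w) (cyclic_module (pi ^+ a)) G]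
      @[n --> \oo] --> l%:E /\
    PB n [set w | is_tensor (B n w) (cyclic_module (pi ^+ a)) G]
      @[n --> \oo] --> l%:E.
Proof.
move=> F kF; have [l Al] := A_limit F kF; exists l; split => //.
have kfin := finite_kappa K_quadratic pi_uniformizer.
have pi0 := uniformizer_neq0 pi_uniformizer.
have [C momC] := moments.
have [I [M [D DP]]] := kpow_ext_reps pi_uniformizer kfin pi0 kF.
have kM k i : D k i -> finite_killed pi a (M k i) by have [h _ _] := DP k => /h[].
(* All limits are chosen at once; off [D] the value 0 is a dummy that enters no sum. *)
have exL (ki : nat * I) : exists L : R, D ki.1 ki.2 ->
    [/\ expectation (PA n) (fun w => (card_Sur (A n w) (M ki.1 ki.2))%:R) @[n --> \oo] --> L%:E,
        expectation (PB n) (fun w => (card_Sur (B n w) (M ki.1 ki.2))%:R) @[n --> \oo] --> L%:E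
      & `|L| <= C * moment_weight pi (M ki.1 ki.2) R].
  case: (boolP (D ki.1 ki.2)) => [/kM/momC[L hL]|_]; last by exists 0.
  by exists L.
have [L0 L0P] := choice exL; pose L k i := L0 (k, i).
have uM k : forall i j, D k i -> D k j -> lmod_iso (M k i) (M k j) -> i = j by have [] := DP k.
have cM k : forall (N : lmodType (ring_of_integers K)) (h : {linear N -> F}),
    finite_killed pi a N -> kpow_ext pi k h ->
    exists2 i, D k i & lmod_iso N (M k i) by have [] := DP k.
have Lb k i : D k i -> `|L k i| <= C * moment_weight pi (M k i) R.
  by move=> Di; have [_ _] := L0P (k, i) Di.
have t0 := tail_cvg0 pi_uniformizer kfin pi0 (proj1 kF) (fun k => let: And3 h _ _ := DP k in h) Lb.
have sA := @tensor_probability_sandwich _ pi R pi_uniformizer kfin pi0 _ _ PA _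
  F a I M D L A_random kF kM uM cM.
have sB := @tensor_probability_sandwich _ pi R pi_uniformizer kfin pi0 _ _ PB _
  F a I M D L B_random kF kM uM cM.
have S0 : 0 < (card_Sur F F)%:R :> R by rewrite ltr0n card_Sur_self_gt0 //; exact: (proj1 kF).
apply: cvg_EFin.
  by apply: nearW => n; exact: fin_num_measure (measurable_tensor_event _ _ (B_random n)).
(* The centres and the error terms are built from the common limits [L], so the same sequences serve
   A and B. *)
apply: (sandwich_cvg S0 (fine_cvg Al) t0).
  by apply: sA => k i Di; have [] := L0P (k, i) Di.
by apply: sB => k i Di; have [] := L0P (k, i) Di.
Qed.
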